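(* Let $n$ be a positive integer. There exist $t,x,y,z\in\mathbb{Z}$ with $t^2+x^2+7y^2+7z^2=n$ if and only if $n$ is not of the form $2^{\varepsilon}\cdot 3\cdot 7^{\ell}$ with $\varepsilon\in\{0,1\}$ and $\ell\in\mathbb{N}_0$.
   Context: $\mathbb{N}_0$ denotes the set of non-negative integers. *)

(* Defs.v *)
From mathcomp Require Import all_boot all_order all_algebra.

(* Main.v *)
Require Import Defs.
From mathcomp Require Import all_boot all_order all_algebra.
From mathcomp Require Import all_field boolp zify ring lra.
From Stdlib Require BinNat Nnat.

(** Write N(y, z) = y^2 + y z + 2 z^2 for the norm form of Z[w], where
    w = (1 + sqrt(-7)) / 2, so that r^2 + 7 s^2 is N restricted to the order
    Z[sqrt(-7)].

    Exceptions.  As -1 is not a square mod 7, 7 | t^2 + x^2 forces 7 | t and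
    7 | x, and dividing by 7 exchanges the two halves of the form.  Hence n is
    represented iff 7 n is, and the exceptional numbers descend to 3 and 6.

    Representations.  The set of represented numbers is stable under
    multiplication by 7 and by 2 (the norm of 1 + i), which reduces everything
    to odd n prime to 7, apart from the values 12 and 24.  The essential claim
    is that the ternary form x^2 + y^2 + 7 z^2 represents every K = 1 mod 4
    prime to 7 ([one_mod4_represented]).  If n = 1 mod 4 one takes K = n.  If
    n = 3 mod 4 one subtracts 7 w^2 for a small odd w, chosen so that
    n - 7 w^2 is 4 K or 16 K with K = 1 mod 4; the n too small for this are
    checked by computation.

    The ternary claim.  The form x^2 + y^2 + 7 z^2 shares its genus with
    another class and is not regular, but x^2 + N(y, z) is alone in its genus:
    reduction theory shows that every positive ternary form of
    half-discriminant 7 is equivalent to it ([ternary_disc7_class]).  If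
    K = 1 mod 4 and K = x^2 + N(y, z), then N(y, z) = 0 or 1 mod 4, and such a
    norm from Z[w] is also a norm from Z[sqrt(-7)] ([norm_in_order]).  So it
    suffices to exhibit one form of half-discriminant 7 that takes the value
    K.  This is possible as soon as there is an odd A such that -A is a square
    mod K and -7 is K times a square mod A.

    The auxiliary number A.  Usually A is taken to be a prime, from Dirichlet's
    theorem on arithmetic progressions.  Here A may be composite, and an
    argument by duality needs much less.  The classes mod K of the admissible
    A, times squares, form a group.  If -1 is outside it, some character chi1
    of order 2 mod K is trivial on that group and equal to -1 at -1.  Let
    chi2(n) be chi1(n) times the Jacobi symbol (n / 7K).  A prime q with
    chi1(q) = chi2(q) = -1 has (q / 7K) = 1, so -7K is a square mod q by
    quadratic reciprocity (proved with Gauss sums in an algebraic closure of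
    F_q).  This makes q admissible and contradicts chi1(q) = -1.

    Existence of q ([common_inert_prime]).  If there is no such q, then the
    Dirichlet convolution f of chi1 and chi2 is nonnegative, and at least 1 at
    the squares prime to the modulus, so that the sum of f(n) (x - n) over
    n <= x grows at least like x^(3/2).  On the other hand, summing over pairs
    (a, b) with a b <= x by the hyperbola method and cancelling the partial
    sums of both characters shows that the same quantity is O(x).  The linear
    weight x - n is what makes this comparison possible with integers only:
    for the unweighted sum, both bounds have order x^(1/2). *)

Set Implicit Arguments.
Unset Strict Implicit.
Unset Printing Implicit Defensive.
Import Order.TTheory GRing.Theory Num.Theory.
Local Open Scope ring_scope.

(** * Ternary forms of half-discriminant 7 *)

Lemma nearest_shift (w d : int) : 0 < d -> exists k, - d <= 2 * (w + d * k) <= d.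
Proof.
move=> d0; exists (- ((2 * w + d) %/ (2 * d))%Z).
have := divz_eq (2 * w + d) (2 * d).
have /andP[] : 0 <= ((2 * w + d) %% (2 * d))%Z < 2 * d.
  by rewrite modz_ge0 ?ltz_pmod //; lia.
move: (_ %/ _)%Z (_ %% _)%Z => s r *; lia.
Qed.

Lemma sqr_le_of_abs_le (x d : int) : - d <= x <= d -> x ^+ 2 <= d ^+ 2.
Proof.
move=> ?; have : 0 <= (d - x) * (d + x) by apply: mulr_ge0; lia.
lia.
Qed.

(** With C = 4 b - w^2, B = 4 c - v^2 and e = 2 u - w v, four times the form is
    (2 x + w y + v z)^2 + (C y^2 + 2 e y z + B z^2), where C B - e^2 = 28.
    Since C is 0 or 3 mod 4, C = 4, and the binary part is 4 y^2 + 7 z^2 or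
    4 y^2 +- 4 y z + 8 z^2; both give x^2 + (y^2 + y z + 2 z^2). *)
Lemma reduced_ternary_disc7 (b c u v w : int) :
  3 <= 4 * b - w ^+ 2 <= 6 ->
  - (4 * b - w ^+ 2) <= 2 * (2 * u - w * v) <= 4 * b - w ^+ 2 ->
  4 * b * c + u * v * w - u ^+ 2 - b * v ^+ 2 - c * w ^+ 2 = 7 ->
  forall x y z, exists x' y' z',
    x ^+ 2 + b * y ^+ 2 + c * z ^+ 2 + u * y * z + v * x * z + w * x * y
    = x' ^+ 2 + (y' ^+ 2 + y' * z' + 2 * z' ^+ 2).
Proof.
move=> C36 kP D7 x y z.
have [s [r [ws r01]]] : exists s r : int, w = 2 * s + r /\ (r = 0 \/ r = 1).
  by exists (w %/ 2)%Z, (w %% 2)%Z; lia.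
have [s' [r' [vs r01']]] : exists s r : int, v = 2 * s + r /\ (r = 0 \/ r = 1).
  by exists (v %/ 2)%Z, (v %% 2)%Z; lia.
have [C defC] : exists C, C = 4 * b - w ^+ 2 by eexists.
have [B defB] : exists B, B = 4 * c - v ^+ 2 by eexists.
have [e def_e] : exists e, e = 2 * u - w * v by eexists.
have G : C * B = 28 + e ^+ 2.
  by rewrite (_ : 28 = 4 * 7) // -D7 defC defB def_e; ring.
rewrite -defC -def_e in C36 kP.
have [C3|C4] : C = 3 \/ C = 4.
- by clear -defC C36 ws r01; subst w; case: r01 => ?; subst r; lia.
- exfalso; clear -C3 G kP; subst C.
  by have [|[|]] : e = 0 \/ e = 1 \/ e = -1 by [lia]; move=> ?; subst e; lia.
have B78 : e = 0 /\ B = 7 \/ (e = 2 \/ e = -2) /\ B = 8.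
  clear -C4 G kP; subst C.
  have [t et] : exists t, e = 2 * t.
    have [q [d [eE d01]]] : exists q d : int, e = 2 * q + d /\ (d = 0 \/ d = 1).
      by exists (e %/ 2)%Z, (e %% 2)%Z; lia.
    by exists q; case: d01 => ?; subst e d; lia.
  subst e; by have [|[|]] : t = 0 \/ t = 1 \/ t = -1 by [lia]; move=> ?; subst t; lia.
have r0 : r = 0 by clear -defC C4 ws r01; subst w; case: r01 => ?; subst r; lia.
have bE : b = 1 + s ^+ 2 by clear -defC C4 ws r0; subst w r; lia.
case: B78 => [[e0 B7]|[e2 B8]].
  have r1' : r' = 1 by clear -defB B7 vs r01'; subst v; case: r01' => ?; subst r'; lia.
  have cE : c = 2 + s' ^+ 2 + s' by clear -defB B7 vs r1'; subst v r'; lia.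
  have uE : u = s * (2 * s' + 1) by clear -def_e e0 ws vs r0 r1'; subst w v r r'; lia.
  exists y, (x + s * y + s' * z), z.
  by rewrite uE bE cE vs ws r0 r1'; ring.
have r0' : r' = 0 by clear -defB B8 vs r01'; subst v; case: r01' => ?; subst r'; lia.
have cE : c = 2 + s' ^+ 2 by clear -defB B8 vs r0'; subst v r'; lia.
have [e1 [e1P eE]] : exists e1 : int, e1 ^+ 2 = 1 /\ e = 2 * e1.
  by case: e2 => ->; [exists 1 | exists (-1)].
have uE : u = 2 * s * s' + e1.
  by clear -def_e eE ws vs r0 r0'; subst w v r r'; lia.
exists (x + s * y + s' * z), y, (e1 * z).
by rewrite uE bE cE vs ws r0 r0' exprMn e1P; ring.
Qed.

(** Gauss's reduction of positive ternary forms.  The hypothesis on 7 says that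
    the half-discriminant is 7.  Two moves alternate: reducing the binary form
    in x, y keeps C = 4 a b - w^2 and lowers a unless 3 a^2 <= C; reducing the
    adjoint binary form in y, z, of determinant 28 a, keeps a and lowers C
    unless 3 C^2 <= 112 a.  When neither applies, 27 a^3 <= 112, so a = 1. *)
Lemma ternary_disc7_class (a b c u v w : int) :
  0 < a -> 0 < 4 * a * b - w ^+ 2 ->
  4 * a * b * c + u * v * w - a * u ^+ 2 - b * v ^+ 2 - c * w ^+ 2 = 7 ->
  forall x y z, exists x' y' z',
    a * x ^+ 2 + b * y ^+ 2 + c * z ^+ 2 + u * y * z + v * x * z + w * x * y
    = x' ^+ 2 + (y' ^+ 2 + y' * z' + 2 * z' ^+ 2).
Proof.
have [n] := ubnP (absz (a + (4 * a * b - w ^+ 2))%R).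
elim: n a b c u v w => // n IH a b c u v w.
have [C defC] : exists C, C = 4 * a * b - w ^+ 2 by eexists.
rewrite -defC => lt_n a0 C0 D7 x y z.
have [C_lt|a_le] := ltP C (3 * a ^+ 2).
  have [|k kP] := @nearest_shift w (2 * a); first lia.
  have [w' def_w'] : exists w', w' = w + 2 * a * k by eexists.
  have [b' def_b'] : exists b', b' = b + w * k + a * k ^+ 2 by eexists.
  have C' : 4 * b' * a - w' ^+ 2 = C by rewrite defC def_b' def_w'; ring.
  have w'_le : w' ^+ 2 <= a ^+ 2.
    by apply: sqr_le_of_abs_le; rewrite def_w'; clear -kP; lia.
  have w'_ge := sqr_ge0 w'.
  have b'0 : 0 < b' by rewrite -(pmulr_lgt0 _ a0); clear -C0 C' w'_ge; lia.
  have b'a : b' < a by rewrite -(ltr_pM2r a0); clear -C_lt C' w'_le; lia.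
  (* The form in x - k y and y, with these two variables exchanged. *)
  have [||||x' [y' [z' e]]] := IH b' a c v (u + k * v) w' _ _ _ _ y (x - k * y) z.
  - by rewrite C'; clear -lt_n C0 a0 b'a b'0; lia.
  - by [].
  - by rewrite C'.
  - by rewrite -D7 def_b' def_w'; ring.
  by exists x', y', z'; rewrite -e def_b' def_w'; ring.
have [k kP] := @nearest_shift (2 * a * u - w * v) C C0.
have [u' def_u'] : exists u', u' = u + 2 * b * k by eexists.
have [v' def_v'] : exists v', v' = v + w * k by eexists.
have [c' def_c'] : exists c', c' = c + u * k + b * k ^+ 2 by eexists.
have D7' : 4 * a * b * c' + u' * v' * w - a * u' ^+ 2 - b * v' ^+ 2 - c' * w ^+ 2 = 7.
  by rewrite -D7 def_u' def_v' def_c'; ring.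
have [B defB] : exists B, B = 4 * a * c' - v' ^+ 2 by eexists.
have [e def_e] : exists e, e = 2 * a * u' - w * v' by eexists.
have G : C * B = 28 * a + e ^+ 2.
  rewrite (_ : 28 * a = 4 * a * 7); last by ring.
  by rewrite -D7' defC defB def_e; ring.
rewrite (_ : _ + C * k = e) in kP; last first.
  by rewrite def_e defC def_u' def_v'; ring.
have -> : a * x ^+ 2 + b * y ^+ 2 + c * z ^+ 2 + u * y * z + v * x * z + w * x * y
  = a * x ^+ 2 + b * (y - k * z) ^+ 2 + c' * z ^+ 2
    + u' * (y - k * z) * z + v' * x * z + w * x * (y - k * z).
  by rewrite def_u' def_v' def_c'; ring.
have [aC|C_le] := ltP (112 * a) (3 * C ^+ 2).
  have e_le := sqr_le_of_abs_le kP.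
  have e_ge := sqr_ge0 e.
  have B0 : 0 < B by rewrite -(pmulr_rgt0 _ C0) G; clear -a0 e_ge; lia.
  have BC : B < C by rewrite -(ltr_pM2l C0) G; clear -C0 e_ge e_le aC; lia.
  (* The form in y - k z and z, with these two variables exchanged. *)
  have [||||x' [y' [z' e']]] := IH a c' b u' w v' _ _ _ _ x z (y - k * z).
  - by rewrite -defB; clear -lt_n BC a0 B0; lia.
  - by [].
  - by rewrite -defB.
  - by rewrite -D7'; ring.
  by exists x', y', z'; rewrite -e'; ring.
have a1 : a = 1.
  suff : a < 2 by clear -a0; lia.
  rewrite ltNge; apply/negP=> a2.
  have a2a : 0 <= (a - 2) * a by apply: mulr_ge0; clear -a2; lia.
  have C6a : 0 <= (C - 6 * a) * (C + 6 * a).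
    by apply: mulr_ge0; clear -a2 a2a a_le; lia.
  clear -a2 a2a C6a C_le; lia.
have C6 : C <= 6.
  rewrite leNgt; apply/negP=> C7.
  have C7C : 0 <= (C - 7) * C by apply: mulr_ge0; clear -C7; lia.
  clear -C_le a1 C7 C7C; lia.
rewrite a1 mul1r; apply: reduced_ternary_disc7.
- by rewrite (_ : 4 * b - _ = C); [clear -C6 a_le a1; lia | rewrite defC a1; ring].
- by move: kP; rewrite def_e defC a1 !mulr1.
- by rewrite -D7' a1; ring.
Qed.

(** * Partial sums of real characters *)

(** The nontrivial real Dirichlet characters mod M. *)
Definition real_character (M : nat) (chi : nat -> int) : Prop :=
  [/\ {morph chi : m n / (m * n)%N >-> m * n},
      forall n, chi (n + M)%N = chi n,
      forall n, coprime n M -> chi n = 1 \/ chi n = -1,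
      forall n, ~~ coprime n M -> chi n = 0
    & exists n, chi n = -1].

Definition partial_sum (phi : nat -> int) (n : nat) : int := \sum_(i < n) phi i.

Lemma partial_sum_periodic M phi n :
  (forall n, phi (n + M)%N = phi n) -> partial_sum phi M = 0 ->
  partial_sum phi (n + M) = partial_sum phi n.
Proof.
rewrite /partial_sum => per sum0; elim: n => [|n IH]; first by rewrite add0n sum0 big_ord0.
by rewrite addSn !big_ord_recr /= IH per.
Qed.

Lemma partial_sum_bounded M phi :
  (0 < M)%N -> (forall n, phi (n + M)%N = phi n) -> partial_sum phi M = 0 ->
  exists2 E : int, 0 <= E & forall n, `|partial_sum phi n| <= E.
Proof.
move=> M0 per sum0; exists (\sum_(i < M) `|phi i|); first by rewrite sumr_ge0.
move=> n; rewrite (divn_eq n M) addnC.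
elim: (n %/ M)%N => [|k IH]; last first.
  by rewrite mulSn addnCA addnC partial_sum_periodic.
rewrite mul0n addn0 /partial_sum; have := ltn_pmod n M0; move: (n %% M)%N => m lt_mM.
apply: le_trans (ler_norm_sum _ _ _) _.
rewrite -(big_mkord xpredT (fun i => `|phi i|)) -(big_mkord xpredT (fun i => `|phi i|)).
rewrite [leRHS](@big_cat_nat _ _ _ m) //=; last exact: ltnW.
by rewrite lerDl sumr_ge0.
Qed.

Lemma abel_summation (phi h : nat -> int) n :
  \sum_(i < n) phi i * h i = partial_sum phi n * h n
    + \sum_(i < n) partial_sum phi i.+1 * (h i - h i.+1).
Proof.
elim: n => [|n IH]; first by rewrite /partial_sum !big_ord0; ring.
rewrite 2!big_ord_recr /= IH.
by rewrite /partial_sum big_ord_recr /=; ring.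
Qed.

(** After partial summation the weights telescope to h 0. *)
Lemma abel_bound (phi h : nat -> int) E n :
  (forall n, `|partial_sum phi n| <= E) ->
  (forall i, 0 <= h i) -> (forall i, h i.+1 <= h i) ->
  `|\sum_(i < n) phi i * h i| <= E * h 0%N.
Proof.
move=> le_E h0 h_dec; rewrite abel_summation.
have tel m : \sum_(i < m) (h i - h i.+1) = h 0%N - h m.
  elim: m => [|m IH]; first by rewrite big_ord0 subrr.
  by rewrite big_ord_recr /= IH; ring.
apply: le_trans (ler_normD _ _) _.
have -> : E * h 0%N = E * h n + \sum_(i < n) E * (h i - h i.+1).
  by rewrite -mulr_sumr tel; ring.
apply: lerD; first by rewrite normrM (ger0_norm (h0 n)) ler_wpM2r.
apply: le_trans (ler_norm_sum _ _ _) _; apply: ler_sum => i _.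
by rewrite normrM [X in _ * X]ger0_norm ?subr_ge0 // ler_wpM2r ?subr_ge0.
Qed.

Section OneCharacter.
Variables (M : nat) (chi : nat -> int).
Hypotheses (M1 : (1 < M)%N) (chiP : real_character M chi).

Let M0 : (0 < M)%N. Proof. exact: ltnW. Qed.

Lemma real_character0 : chi 0%N = 0.
Proof. by case: chiP => _ _ _ chi0 _; apply: chi0; rewrite /coprime gcd0n gtn_eqF. Qed.

Lemma real_character_norm n : `|chi n| <= 1.
Proof.
case: chiP => _ _ unit zero _; have [/unit|/zero->] := boolP (coprime n M); last by [].
by case=> ->.
Qed.

Lemma real_character_mod n : chi (n %% M)%N = chi n.
Proof.
case: chiP => _ per _ _ _; rewrite [in RHS](divn_eq n M) addnC.
elim: (n %/ M)%N => [|k IH]; first by rewrite mul0n addn0.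
by rewrite mulSn [in RHS]addnCA [in RHS]addnC per.
Qed.

(** Multiplication by an n0 with chi n0 = -1 permutes the residues and changes
    the sign of the sum. *)
Lemma real_character_sum0 : partial_sum chi M = 0.
Proof.
case: chiP => mor _ _ zero [n0 chin0].
have co : coprime n0 M.
  by apply/negPn/negP => /zero; rewrite chin0.
pose f (i : 'I_M) := Ordinal (ltn_pmod (n0 * i) M0).
have f_inj : injective f.
  move=> i j [] /eqP.
  wlog le_ij : i j / (i <= j)%N.
    by move=> H; case/orP: (leq_total i j) => /H // H' /eqP ?; apply/esym/H'/eqP.
  rewrite eq_sym eqn_mod_dvd ?leq_mul2l ?le_ij ?orbT //.
  rewrite -mulnBr Gauss_dvdr 1?coprime_sym // => /eqP dv.
  apply: val_inj => /=; apply/eqP; rewrite eqn_leq le_ij /= -subn_eq0 -dv.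
  by rewrite modn_small // ltn_subLR // (leq_trans (ltn_ord j)) ?leq_addl.
have : partial_sum chi M = - partial_sum chi M.
  rewrite {1}/partial_sum (reindex_inj f_inj) /= -sumrN.
  by apply: eq_bigr => i _; rewrite real_character_mod mor chin0 mulN1r.
by lia.
Qed.

Lemma real_character_bounded :
  exists2 E : int, 0 <= E & forall n, `|partial_sum chi n| <= E.
Proof.
by case: chiP => _ per _ _ _; apply: partial_sum_bounded M0 per real_character_sum0.
Qed.

(** The truncated subtraction restricts the sum to the b with a b <= x. *)
Definition smoothed_sum (a x : nat) : int :=
  \sum_(b < x.+1) chi b * (x - a * b)%N%:Z.

(** Two partial summations.  The first leaves the partial sums of chi against
    the decrements of x - a b, which add up to x; M times these partial sums
    is a constant C plus a function of mean zero over a period.  Since the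
    weight is convex in b, its decrements are monotone and start at a, so the
    second summation leaves an error O(a). *)
Lemma smoothed_sum_linear :
  exists C, exists2 E : int, 0 <= E & forall a x, (0 < a)%N ->
    `|M%:Z * smoothed_sum a x - C * x%:Z| <= E * a%:Z.
Proof.
case: chiP => _ per _ _ _.
pose s i := partial_sum chi i.+1.
pose C := \sum_(i < M) s i; exists C.
pose phi i := M%:Z * s i - C.
have s_per i : s (i + M)%N = s i.
  by rewrite /s -addSn partial_sum_periodic // real_character_sum0.
have phi0 : partial_sum phi M = 0.
  rewrite /partial_sum /phi big_split /= -mulr_sumr sumrN sumr_const card_ord -/C.
  by rewrite -[C *+ M]mulr_natl natz subrr.
have [E E0 phi_le] : exists2 E : int, 0 <= E & forall n, `|partial_sum phi n| <= E.
  by apply: partial_sum_bounded M0 _ phi0 => n; rewrite /phi s_per.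
exists E => // a x a0; rewrite /smoothed_sum.
pose g b : int := (x - a * b)%N%:Z; pose dg b := g b - g b.+1.
have gx : g x.+1 = 0 by rewrite /g (eqP (_ : (x - a * x.+1)%N == 0%N)) //; nia.
rewrite (abel_summation chi g) gx mulr0 add0r.
have -> : M%:Z * (\sum_(i < x.+1) partial_sum chi i.+1 * (g i - g i.+1)) - C * x%:Z
    = \sum_(i < x.+1) phi i * dg i.
  have tel m : \sum_(i < m) dg i = g 0%N - g m.
    elim: m => [|m IH]; first by rewrite big_ord0 subrr.
    by rewrite big_ord_recr /= IH /dg; ring.
  have -> : x%:Z = \sum_(i < x.+1) dg i by rewrite tel gx /g muln0 subn0 subr0.
  rewrite !mulr_sumr -sumrB; apply: eq_bigr => i _.
  by rewrite /phi /dg /s; ring.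
apply: le_trans (abel_bound _ phi_le _ _) _.
- by move=> i; rewrite /dg /g mulnS; lia.
- by move=> i; rewrite /dg /g !mulnS; lia.
by rewrite ler_wpM2l // /dg /g muln1 muln0; lia.
Qed.

(** The increasing weight a is replaced by the decreasing weight N - a. *)
Lemma weighted_sum_bounded E N :
  (forall n, `|partial_sum chi n| <= E) ->
  `|\sum_(a < N.+1) chi a * a%:Z| <= 2 * E * N%:Z.
Proof.
move=> le_E.
have le1 : `|\sum_(a < N.+1) chi a * (N - a)%N%:Z| <= E * N%:Z.
  apply: le_trans (abel_bound (h := fun a => (N - a)%N%:Z) _ le_E _ _) _ => //.
    by move=> i; lia.
  by rewrite subn0.
have -> : \sum_(a < N.+1) chi a * a%:Z
    = partial_sum chi N.+1 * N%:Z - \sum_(a < N.+1) chi a * (N - a)%N%:Z.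
  rewrite /partial_sum mulr_suml -sumrB; apply: eq_bigr => i _.
  by rewrite -mulrBr; congr (_ * _); have := ltn_ord i; lia.
apply: le_trans (ler_normB _ _) _; rewrite (_ : 2 * E * N%:Z = E * N%:Z + E * N%:Z).
  by apply: lerD le1; rewrite normrM ler_wpM2r.
by ring.
Qed.

End OneCharacter.

(** * A prime at which two real characters are both -1 *)

Lemma big_divisors_coprime (m n : nat) (F : nat -> int) :
  (0 < m)%N -> (0 < n)%N -> coprime m n ->
  \sum_(d <- divisors (m * n)) F d
    = \sum_(d <- divisors m) \sum_(e <- divisors n) F (d * e)%N.
Proof.
move=> m0 n0 co; have mn0 : (0 < m * n)%N by rewrite muln_gt0 m0.
rewrite -(big_allpairs_dep (h := muln)); apply: perm_big; apply: uniq_perm.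
- exact: divisors_uniq.
- apply: allpairs_uniq; rewrite ?divisors_uniq // => -[d e] [d' e'] /=.
  case/allpairsP=> -[x y] /= [+ + [-> ->]]; rewrite -!dvdn_divisors // => dm en.
  case/allpairsP=> -[x' y'] /= [+ + [-> ->]]; rewrite -!dvdn_divisors // => d'm e'n eq_p.
  have gm u v : (u %| m)%N -> (v %| n)%N -> gcdn (u * v) m = u.
    move=> um vn; rewrite gcdnC Gauss_gcdl ?(coprime_dvdr vn) //.
    by rewrite gcdnC; apply/gcdn_idPl.
  have gn u v : (u %| m)%N -> (v %| n)%N -> gcdn (u * v) n = v.
    move=> um vn; rewrite gcdnC Gauss_gcdr ?(coprime_dvdr um) 1?coprime_sym //.
    by rewrite gcdnC; apply/gcdn_idPl.
  move: eq_p => /= eq_p; have := gn _ _ dm en; have := gm _ _ dm en.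
  by rewrite eq_p gm // gn // => -> ->.
move=> d; rewrite -dvdn_divisors //; apply/idP/allpairsP => [dmn|].
  exists (gcdn d m, gcdn d n) => /=; rewrite -!dvdn_divisors ?dvdn_gcdr //; split=> //.
  apply/eqP; rewrite eqn_dvd; apply/andP; split; last first.
    rewrite Gauss_dvd ?dvdn_gcdl //.
    by rewrite (coprime_dvdl (dvdn_gcdr d m)) // (coprime_dvdr (dvdn_gcdr d n)).
  by rewrite muln_gcdl dvdn_gcd dvdn_mulr //= muln_gcdr dvdn_gcd dvdn_mull.
by case=> -[x y] /= []; rewrite -!dvdn_divisors // => xm yn ->; apply: dvdn_mul.
Qed.

Lemma big_divisors_primepow (p k : nat) (F : nat -> int) :
  prime p -> \sum_(d <- divisors (p ^ k)) F d = \sum_(i < k.+1) F (p ^ i)%N.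
Proof.
move=> pr; rewrite -(big_mkord xpredT (fun i => F (p ^ i)%N)) -(big_map (expn p) xpredT F).
apply: perm_big; apply: uniq_perm.
- exact: divisors_uniq.
- by rewrite map_inj_uniq ?iota_uniq // => i j /eqP; rewrite eqn_exp2l ?prime_gt1 // => /eqP.
move=> d; rewrite -dvdn_divisors ?expn_gt0 ?prime_gt0 //.
apply/(dvdn_pfactor _ _ pr)/mapP => -[i]; rewrite ?mem_index_iota ?ltnS => ik ->.
  by exists i; rewrite ?mem_index_iota.
by exists i.
Qed.

Section TwoCharacters.
Variables (M : nat) (chi1 chi2 : nat -> int).
Hypotheses (M1 : (1 < M)%N).
Hypotheses (chi1P : real_character M chi1) (chi2P : real_character M chi2).

Definition char_conv (n : nat) : int :=
  \sum_(d <- divisors n) chi1 d * chi2 (n %/ d)%N.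

(** Both the partial sums of the convolution with weight x - n, by
    [smoothed_convE], and a sum over a lattice region, which the hyperbola
    method can treat. *)
Definition smoothed_conv (x : nat) : int :=
  \sum_(a < x.+1) \sum_(b < x.+1) chi1 a * chi2 b * (x - a * b)%N%:Z.

(** Dirichlet's hyperbola method with x = N^2: every pair with a b <= x has
    a <= N or b <= N.  In the part a <= N the inner sum is C x / M + O(a), and
    the main term C x / M is multiplied by a bounded partial sum; so each part
    is O(x). *)
Lemma smoothed_conv_small :
  exists2 E : int, 0 <= E & forall N, `|smoothed_conv (N ^ 2)| <= E * (N ^ 2)%N%:Z.
Proof.
have [E1 E1_0 leE1] := real_character_bounded M1 chi1P.
have [E2 E2_0 leE2] := real_character_bounded M1 chi2P.
have [C1 [F1 F1_0 leF1]] := smoothed_sum_linear M1 chi1P.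
have [C2 [F2 F2_0 leF2]] := smoothed_sum_linear M1 chi2P.
exists (`|C2| * E1 + F2 + (`|C1| * E2 + F1) + M%:Z * (E1 * E2 + 4 * E1 * E2)).
  by repeat first [done | apply: addr_ge0 | apply: mulr_ge0].
case=> [|N'].
  rewrite /smoothed_conv big1 ?normr0 ?mulr0 // => i _.
  by rewrite big1 // => j _; rewrite mulr0.
set N := N'.+1; set x := (N ^ 2)%N.
pose G a b := chi1 a * chi2 b * (x - a * b)%N%:Z.
have le_Nx : (N <= x)%N by rewrite /x -mulnn leq_pmulr.
have cut (H : nat -> int) :
    \sum_(a < x.+1) H a = \sum_(a < N.+1) H a + \sum_(N.+1 <= a < x.+1) H a.
  by rewrite -!(big_mkord xpredT H) -big_cat_nat.
have split3 : smoothed_conv x = \sum_(a < N.+1) \sum_(b < x.+1) G a b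
    + \sum_(b < N.+1) \sum_(a < x.+1) G a b - \sum_(a < N.+1) \sum_(b < N.+1) G a b.
  rewrite /smoothed_conv (cut (fun a => \sum_(b < x.+1) G a b)) -addrA; congr (_ + _).
  under [X in _ = X - _]eq_bigr do rewrite (cut (fun a => G a _)).
  rewrite big_split /= [X in _ = X + _ - _]exchange_big /= addrAC subrr add0r.
  rewrite [RHS]exchange_big /=; apply: eq_big_nat => a /andP[aN _].
  rewrite (cut (G a)) [X in _ + X]big1_seq ?addr0 // => b /= /[!mem_index_iota] /andP[bN _].
  by rewrite /G (eqP (_ : (x - a * b)%N == 0%N)) ?mulr0 // subn_eq0 /x -mulnn leq_mul // ltnW.
have bound chi chi' E C F : (forall n, `|partial_sum chi n| <= E) ->
    real_character M chi -> 0 <= F ->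
    (forall a x, (0 < a)%N -> `|M%:Z * smoothed_sum chi' a x - C * x%:Z| <= F * a%:Z) ->
    `|M%:Z * \sum_(a < N.+1) chi a * smoothed_sum chi' a x| <= (`|C| * E + F) * x%:Z.
  move=> leE chiP F0 leF.
  have -> : M%:Z * \sum_(a < N.+1) chi a * smoothed_sum chi' a x
      = partial_sum chi N.+1 * C * x%:Z
        + \sum_(a < N.+1) chi a * (M%:Z * smoothed_sum chi' a x - C * x%:Z).
    rewrite /partial_sum !mulr_suml mulr_sumr -big_split; apply: eq_bigr => a _ /=.
    by ring.
  apply: le_trans (ler_normD _ _) _; rewrite mulrDl; apply: lerD.
    rewrite !normrM ler_wpM2r // mulrC ler_wpM2l //.
  apply: le_trans (ler_norm_sum _ _ _) _.
  apply: (@le_trans _ _ (\sum_(a < N.+1) F * a%:Z)).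
    apply: ler_sum => -[[|a] lt_a] _ /=.
      by rewrite (real_character0 M1 chiP) mul0r normr0 mulr0.
    rewrite normrM -[leRHS]mul1r ler_pM // ?leF //.
    exact: real_character_norm chiP _.
  rewrite -mulr_sumr ler_wpM2l // /x.
  elim: (N) => [|n IH]; first by rewrite big_ord1.
  rewrite big_ord_recr /=; apply: le_trans (lerD IH (lexx _)) _.
  by rewrite -!mulnn; lia.
have [b1 b2] := (bound _ _ _ _ _ leE1 chi1P F2_0 leF2, bound _ _ _ _ _ leE2 chi2P F1_0 leF1).
have b3 : `|\sum_(a < N.+1) \sum_(b < N.+1) G a b| <= (E1 * E2 + 4 * E1 * E2) * x%:Z.
  have -> : \sum_(a < N.+1) \sum_(b < N.+1) G a b
      = partial_sum chi1 N.+1 * partial_sum chi2 N.+1 * x%:Z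
        - (\sum_(a < N.+1) chi1 a * a%:Z) * (\sum_(b < N.+1) chi2 b * b%:Z).
    rewrite /partial_sum !big_distrlr /= mulr_suml -sumrB; apply: eq_bigr => a _.
    rewrite mulr_suml -sumrB; apply: eq_bigr => b _.
    rewrite /G -subzn; first by rewrite PoszM; ring.
    by rewrite /x -mulnn leq_mul // -ltnS.
  apply: le_trans (ler_normB _ _) _; rewrite !normrM mulrDl; apply: lerD.
    by rewrite ler_wpM2r // ler_pM.
  have -> : 4 * E1 * E2 * x%:Z = (2 * E1 * N%:Z) * (2 * E2 * N%:Z).
    by rewrite /x -mulnn PoszM; ring.
  by apply: ler_pM => //; exact: weighted_sum_bounded.
have MW : `|M%:Z * smoothed_conv x| <= (`|C2| * E1 + F2 + (`|C1| * E2 + F1)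
    + M%:Z * (E1 * E2 + 4 * E1 * E2)) * x%:Z.
  rewrite split3 mulrBr mulrDr [leRHS]mulrDl.
  apply: le_trans (ler_normB _ _) _; apply: lerD; last first.
    by rewrite normrM -[leRHS]mulrA ger0_norm // ler_wpM2l.
  apply: le_trans (ler_normD _ _) _; rewrite mulrDl; apply: lerD.
    apply: le_trans b1; rewrite le_eqVlt; apply/orP; left; apply/eqP.
    congr (`|_ * _|); apply: eq_bigr => a _; rewrite /smoothed_sum mulr_sumr.
    by apply: eq_bigr => b _; rewrite /G mulrA.
  apply: le_trans b2; rewrite le_eqVlt; apply/orP; left; apply/eqP.
  congr (`|_ * _|); apply: eq_bigr => b _; rewrite /smoothed_sum mulr_sumr.
  by apply: eq_bigr => a _; rewrite /G mulrCA mulrA mulnC.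
apply: le_trans MW; rewrite normrM -[leLHS]mul1r ler_wpM2r //.
by rewrite ger0_norm //; lia.
Qed.

Lemma char_conv0 : char_conv 0 = 0.
Proof. by rewrite /char_conv big_seq1 div0n (real_character0 M1 chi2P) mulr0. Qed.

Lemma smoothed_convE x :
  smoothed_conv x = \sum_(n < x.+1) char_conv n * (x - n)%N%:Z.
Proof.
pose H a b n : int := if (a * b == n)%N then chi1 a * chi2 b * (x - n)%N%:Z else 0.
have -> : smoothed_conv x = \sum_(a < x.+1) \sum_(b < x.+1) \sum_(n < x.+1) H a b n.
  apply: eq_bigr => a _; apply: eq_bigr => b _; rewrite /H -big_mkcond /=.
  have [lt_ab|le_x] := ltnP (a * b) x.+1.
    by rewrite (big_pred1 (Ordinal lt_ab)).
  rewrite big_pred0; last by move=> n; apply/negP=> /eqP ab; move: (ltn_ord n); lia.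
  by rewrite (eqP (_ : (x - a * b)%N == 0%N)) ?mulr0 // subn_eq0 ltnW.
under eq_bigr do rewrite exchange_big /=; rewrite exchange_big /=.
apply: eq_bigr => -[[|n] lt_n] _ /=.
  rewrite char_conv0 mul0r big1 // => a _; rewrite big1 // => b _.
  rewrite /H muln_eq0; case: eqP => [->|_]; first by rewrite (real_character0 M1 chi1P) !mul0r.
  by case: eqP => [->|//]; rewrite (real_character0 M1 chi2P) mulr0 mul0r.
rewrite /char_conv mulr_suml.
transitivity (\sum_(a < x.+1 | (a %| n.+1)%N)
    chi1 a * chi2 (n.+1 %/ a)%N * (x - n.+1)%N%:Z).
  rewrite [RHS]big_mkcond; apply: eq_bigr => a _ /=.
  case: ifP => [/dvdnP[b def_n]|ndv]; last first.
    rewrite big1 // => b _; rewrite /H; case: eqP => // ab.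
    by rewrite -ab dvdn_mulr in ndv.
  have a0 : (0 < a)%N by case: (nat_of_ord a) def_n => //; rewrite muln0.
  have lt_b : (b < x.+1)%N by apply: leq_ltn_trans lt_n; rewrite def_n leq_pmulr.
  rewrite (bigD1 (Ordinal lt_b)) //= big1 => [|b' neq_b]; rewrite /H.
    have -> : (n.+1 %/ a)%N = b by rewrite def_n mulnK.
    by rewrite /= mulnC -def_n eqxx addr0.
  case: eqP => // ab; case/negP: neq_b; apply/eqP/val_inj/eqP => /=.
  by rewrite -(eqn_pmul2r a0) -def_n -ab mulnC.
rewrite -(big_mkord (fun a => a %| n.+1)%N
  (fun a => chi1 a * chi2 (n.+1 %/ a)%N * (x - n.+1)%N%:Z)) -big_filter.
apply: perm_big; apply: uniq_perm; rewrite ?divisors_uniq ?filter_uniq ?iota_uniq //.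
move=> a; rewrite mem_filter mem_index_iota -dvdn_divisors //= andbC.
apply: andb_idl => /dvdn_leq -/(_ isT) le_an.
exact: leq_ltn_trans le_an lt_n.
Qed.

Lemma char_conv_coprime m n : (0 < m)%N -> (0 < n)%N -> coprime m n ->
  char_conv (m * n) = char_conv m * char_conv n.
Proof.
move=> m0 n0 co; rewrite /char_conv big_divisors_coprime // big_distrlr /=.
rewrite big_seq [RHS]big_seq; apply: eq_bigr => d.
rewrite -dvdn_divisors // => /dvdnP[d' ->].
rewrite big_seq [RHS]big_seq; apply: eq_bigr => e.
rewrite -dvdn_divisors // => /dvdnP[e' ->].
case: (posnP d) => [->|d0]; first by rewrite mul0n (real_character0 M1 chi1P) !mul0r.
case: (posnP e) => [->|e0].
  by rewrite muln0 (real_character0 M1 chi1P) !mul0r mulr0.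
rewrite mulnACA !mulnK ?muln_gt0 ?d0 //.
by case: chi1P chi2P => -> _ _ _ _ [-> _ _ _ _]; ring.
Qed.

Lemma real_character1 chi : real_character M chi -> chi 1%N = 1.
Proof.
by case=> mor _ _ _ [n0 chin0]; have := mor 1%N n0; rewrite mul1n chin0; lia.
Qed.

Lemma real_characterX chi p k : real_character M chi -> chi (p ^ k)%N = chi p ^+ k.
Proof.
move=> chiP; elim: k => [|k IH]; first by rewrite real_character1.
by case: (chiP) => mor _ _ _ _; rewrite expnS exprS mor IH.
Qed.

Lemma alternating_sum k : \sum_(i < k.+1) (-1) ^+ i = (~~ odd k)%:Z.
Proof.
elim: k => [|k IH]; first by rewrite big_ord1.
by rewrite big_ord_recr /= IH -signr_odd /=; case: (odd k).
Qed.

Hypothesis no_common_inert : forall q, prime q -> chi1 q = -1 -> chi2 q = -1 -> False.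

(** At a prime p not dividing M whose values are not both -1, the sum of
    chi1(p)^i chi2(p)^(k - i) is k + 1, or an alternating sum equal to 1 or 0
    according to the parity of k. *)
Lemma char_conv_primepow p k : prime p ->
  0 <= char_conv (p ^ k) /\ (coprime p M -> ~~ odd k -> 1 <= char_conv (p ^ k)).
Proof.
move=> pr; rewrite /char_conv big_divisors_primepow //.
have -> : \sum_(i < k.+1) chi1 (p ^ i)%N * chi2 (p ^ k %/ p ^ i)%N
    = \sum_(i < k.+1) chi1 p ^+ i * chi2 p ^+ (k - i).
  apply: eq_bigr => i _; have le_ik : (i <= k)%N by rewrite -ltnS.
  by rewrite -(expnB (prime_gt0 pr) le_ik) (real_characterX _ _ chi1P) (real_characterX _ _ chi2P).
have [_ _ unit1 zero1 _] := chi1P; have [_ _ unit2 zero2 _] := chi2P.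
have [co|nco] := boolP (coprime p M); last first.
  split=> //; rewrite zero1 // zero2 //; apply: sumr_ge0 => i _.
  by rewrite -exprD exprn_ge0.
have rev : \sum_(i < k.+1) (-1 : int) ^+ (k - i) = (~~ odd k)%:Z.
  rewrite -alternating_sum (reindex_inj rev_ord_inj) /=.
  by apply: eq_bigr => i _; rewrite subSS subKn // -ltnS.
case: (unit1 _ co) (@no_common_inert _ pr) => -> no; case: (unit2 _ co) no => -> no.
- under eq_bigr do rewrite !expr1n mulr1.
  by rewrite sumr_const card_ord; split=> // _ _; rewrite -mulr_natl mulr1; lia.
- under eq_bigr do rewrite expr1n mul1r.
  by rewrite rev; case: (odd k).
- under eq_bigr do rewrite expr1n mulr1.
  by rewrite alternating_sum; case: (odd k).
- by case: no.
Qed.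

(** The convolution is multiplicative, so prime powers decide its sign. *)
Lemma char_conv_ge0 n : (0 < n)%N ->
  0 <= char_conv n /\ (coprime n M -> (exists m, n = m ^ 2)%N -> 1 <= char_conv n).
Proof.
have [m] := ubnP n; elim: m n => // m IH n lt_nm n0.
have [n1|n1] := leqP n 1.
  have -> : n = 1%N by lia.
  by rewrite /char_conv big_seq1 divnn /= !real_character1.
pose p := pdiv n; have pr : prime p by exact: pdiv_prime.
have [n' co def_n] := pfactor_coprime pr n0.
have p1 := prime_gt1 pr.
have k0 : (0 < logn p n)%N by rewrite logn_gt0 mem_primes pr n0 pdiv_dvd.
have n'0 : (0 < n')%N by case: (n') def_n => //; lia.
have lt_n' : (n' < n)%N.
  by rewrite [ltnRHS]def_n -{1}(muln1 n') ltn_pmul2l // -(expn0 p) ltn_exp2l.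
have co' : coprime n' (p ^ logn p n) by rewrite coprime_sym coprimeXl.
have [|//|ge0 ge1] := IH n'; first by lia.
have [ge0p ge1p] := @char_conv_primepow p (logn p n) pr.
have -> : char_conv n = char_conv n' * char_conv (p ^ logn p n).
  by rewrite -char_conv_coprime -?def_n // expn_gt0 prime_gt0.
split; first exact: mulr_ge0.
rewrite {1}def_n coprimeMl => /andP[con' cop] [a def_a].
rewrite coprime_pexpl // in cop.
have a0 : (0 < a)%N by case: (a) def_a n0 => // ->.
have [a' coa def_a'] := pfactor_coprime pr a0.
have log2 : logn p n = (2 * logn p a)%N by rewrite def_a lognX.
rewrite -[1]mulr1; apply: ler_pM => //; last by apply: ge1p; rewrite // log2 oddM.
apply: ge1 => //; exists a'; apply/eqP.
rewrite -(@eqn_pmul2r (p ^ logn p n)) ?expn_gt0 ?prime_gt0 // -def_n.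
by rewrite log2 [(2 * _)%N]mulnC expnM -expnMn -def_a' -def_a.
Qed.

(** For x = N^2 with N = 2 M k, the k squares of the numbers 1 + j M, j < k,
    are prime to M and at most x / 4; each contributes at least 3 x / 4. *)
Lemma smoothed_conv_large k :
  3 * k%:Z * ((2 * M * k) ^ 2)%N%:Z <= 4 * smoothed_conv ((2 * M * k) ^ 2).
Proof.
set N := (2 * M * k)%N; set x := (N ^ 2)%N.
pose F n := char_conv n * (x - n)%N%:Z.
have F0 n : 0 <= F n.
  case: n => [|n]; last by rewrite mulr_ge0 //; case: (@char_conv_ge0 n.+1).
  by rewrite /F char_conv0 mul0r.
pose e (j : 'I_k) : 'I_x.+1 := inord ((1 + j * M) ^ 2).
have le_e (j : 'I_k) : (2 * (1 + j * M) <= N)%N.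
  rewrite /N -mulnA leq_mul2l /=; have := ltn_ord j.
  have := ltnW M1; move: (nat_of_ord j) => i; nia.
have val_e (j : 'I_k) : e j = ((1 + j * M) ^ 2)%N :> nat.
  rewrite /e inordK // ltnS leq_exp2r //; apply: leq_trans (le_e j).
  by rewrite leq_pmull.
have e_inj : injective e.
  move=> i j /(congr1 val) /=; rewrite !val_e => /eqP; rewrite eqn_exp2r //.
  by rewrite eqn_add2l eqn_pmul2r ?(ltnW M1) // => /eqP/val_inj.
have big : \sum_(j < k) F (e j) <= smoothed_conv x.
  rewrite smoothed_convE -(big_imset (fun n : 'I_x.+1 => F n)) /=; last first.
    by move=> i j _ _; exact: e_inj.
  rewrite [leRHS](bigID (mem [set e x | x in predT])) /= lerDl sumr_ge0 // => i _.
  exact: F0.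
apply: le_trans (_ : _ <= 4 * \sum_(j < k) F (e j)) _; last by lia.
rewrite mulr_sumr.
have -> : 3 * k%:Z * x%:Z = \sum_(j < k) 3 * x%:Z.
  by rewrite sumr_const card_ord -mulr_natl natz; ring.
apply: ler_sum => j _.
have c1 : 1 <= char_conv (e j).
  rewrite val_e; have [|_ ge1] := @char_conv_ge0 ((1 + j * M) ^ 2); first by rewrite expn_gt0.
  by apply: ge1; [rewrite coprimeXl // /coprime addnC gcdnC gcdnMDl gcdn1 | exists (1 + j * M)%N].
have x4 : (4 * e j <= x)%N.
  by rewrite val_e /x -[4%N]/(2 ^ 2)%N -expnMn leq_exp2r.
have : 0 <= (char_conv (e j) - 1) * (x - e j)%N%:Z by rewrite mulr_ge0 // subr_ge0.
rewrite /F; lia.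
Qed.

(** The lower bound exceeds the upper one as soon as k > 4 E / 3. *)
Lemma two_characters_absurd : False.
Proof.
have [E E0 upper] := smoothed_conv_small.
pose k := (2 * absz E + 1)%N.
have low := smoothed_conv_large k; have up := upper (2 * M * k)%N.
have x0 : (0 < (2 * M * k) ^ 2)%N by rewrite expn_gt0 !muln_gt0 (ltnW M1) /k addn1.
set x := ((2 * M * k) ^ 2)%N in low up x0; set W := smoothed_conv x in low up.
have {}up : W <= E * x%:Z by apply: le_trans up; apply: ler_norm.
have kE : k%:Z = 2 * E + 1 by rewrite /k; lia.
have Ex : 0 <= E * x%:Z by rewrite mulr_ge0.
rewrite kE in low; clearbody x W; clear -low up x0 Ex; lia.
Qed.

End TwoCharacters.

Lemma common_inert_prime M chi1 chi2 :
  (1 < M)%N -> real_character M chi1 -> real_character M chi2 ->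
  exists q, [/\ prime q, chi1 q = -1 & chi2 q = -1].
Proof.
move=> M1 chi1P chi2P; apply: contrapT => no.
apply: (two_characters_absurd M1 chi1P chi2P) => q pr c1 c2.
by apply: no; exists q.
Qed.

Lemma real_character_of_units M (c : nat -> int) :
  (forall m n, coprime m M -> coprime n M -> c (m * n)%N = c m * c n) ->
  (forall n, c (n + M)%N = c n) ->
  (forall n, coprime n M -> c n = 1 \/ c n = -1) ->
  (exists2 n, coprime n M & c n = -1) ->
  real_character M (fun n => if coprime n M then c n else 0).
Proof.
move=> mul per val [n0 co0 cn0]; split.
- move=> m n /=; rewrite coprimeMl; case: (boolP (coprime m M)) => com /=; last by rewrite mul0r.
  by case: ifP => con; rewrite ?mulr0 // mul.
- move=> n; rewrite per; suff -> : coprime (n + M) M = coprime n M by [].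
  by rewrite ![coprime _ M]coprime_sym /coprime gcdnDr.
- by move=> n co; rewrite co; apply: val.
- by move=> n /negPf->.
by exists n0; rewrite co0.
Qed.

(** * Legendre symbols, Gauss sums and reciprocity *)

(** Euler's criterion, taken as the definition of the Legendre symbol. *)
Definition legendre (p : nat) (a : 'F_p) : int :=
  if a == 0 then 0 else if a ^+ p./2 == 1 then 1 else -1.

Section Legendre.
Variables (p : nat) (pr : prime p) (p_odd : odd p).

Lemma half_odd_prime_gt0 : (0 < p./2)%N.
Proof. by case: p pr p_odd => [|[|[|]]]. Qed.

Lemma Fp_neq_opp1 : (1 : 'F_p) != -1.
Proof.
rewrite -subr_eq0 opprK -(natrD _ 1 1) -(dvdn_pcharf (pchar_Fp pr)).
by rewrite gtnNdvd //; case: p pr p_odd => [|[|[|]]].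
Qed.

Lemma Fp_expX_half (a : 'F_p) : a != 0 -> a ^+ p./2 = 1 \/ a ^+ p./2 = -1.
Proof.
have pE : p = (p./2 * 2).+1 by rewrite muln2 -{1}(odd_double_half p) p_odd.
move=> a0; have : a * (a ^+ p./2) ^+ 2 = a * 1.
  by rewrite mulr1 -exprM -exprS -pE; have := expf_card a; rewrite card_Fp.
move/(mulfI a0)/eqP.
by rewrite sqrf_eq1 => /orP[]/eqP; [left | right].
Qed.

Lemma legendre_half (a : 'F_p) : (legendre a)%:~R = a ^+ p./2.
Proof.
rewrite /legendre; case: eqP => [->|/eqP a0].
  by rewrite expr0n gtn_eqF // half_odd_prime_gt0.
by case: (Fp_expX_half a0) => ->; rewrite ?eqxx // eq_sym (negPf Fp_neq_opp1) rmorphN1.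
Qed.

Lemma legendre_eq (x y : int) : 
  x \in [:: 0; 1; -1] -> y \in [:: 0; 1; -1] -> x%:~R = y%:~R :> 'F_p -> x = y.
Proof.
rewrite !inE => /or3P[]/eqP-> /or3P[]/eqP-> //; rewrite ?(mulr0z, mulr1z, rmorphN1).
all: move=> /eqP; rewrite ?oppr_eq0 ?oner_eq0 ?(negPf Fp_neq_opp1) // eq_sym.
all: by rewrite ?oppr_eq0 ?oner_eq0 ?(negPf Fp_neq_opp1).
Qed.

Lemma legendre_mem (a : 'F_p) : legendre a \in [:: 0; 1; -1].
Proof. by rewrite /legendre; case: ifP => // _; case: ifP. Qed.

Lemma legendreM : {morph @legendre p : a b / a * b}.
Proof.
move=> a b; apply: legendre_eq; rewrite ?legendre_mem //.
  have := (legendre_mem a, legendre_mem b); rewrite !inE => -[].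
  by move=> /or3P[]/eqP-> /or3P[]/eqP->.
by rewrite rmorphM /= !legendre_half exprMn.
Qed.

Lemma legendre0 : legendre (0 : 'F_p) = 0.
Proof. by rewrite /legendre eqxx. Qed.

Lemma legendre1 : legendre (1 : 'F_p) = 1.
Proof. by rewrite /legendre oner_eq0 expr1n eqxx. Qed.

Lemma legendreN1 : legendre (-1 : 'F_p) = (-1) ^+ p./2.
Proof.
apply: legendre_eq; rewrite ?legendre_mem //.
  by rewrite -signr_odd; case: odd.
by rewrite legendre_half rmorphXn /= rmorphN1.
Qed.

Lemma legendre_sq (a : 'F_p) : a != 0 -> legendre a * legendre a = 1.
Proof. by rewrite /legendre => /negPf->; case: ifP. Qed.

(** Otherwise X^((p-1)/2) - 1 would have p - 1 roots. *)
Lemma legendre_nonresidue : exists a : 'F_p, legendre a = -1.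
Proof.
have h0 := half_odd_prime_gt0.
case: (pickP (fun a : 'F_p => legendre a == -1)) => [a /eqP|no]; first by exists a.
pose P : {poly 'F_p} := 'X^(p./2) - 1.
have sP : size P = (p./2).+1 by rewrite size_XnsubC.
have P0 : P != 0 by rewrite -size_poly_eq0 sP.
have rP : all (root P) (enum (predC1 (0 : 'F_p))).
  apply/allP => a; rewrite mem_enum => a0.
  have := no a; rewrite /legendre (negPf a0) rootE !hornerE subr_eq0.
  by case: (_ == 1).
have := max_poly_roots P0 rP (enum_uniq _).
by rewrite sP -cardE cardC1 card_Fp //; lia.
Qed.

Lemma legendre_sum0 : \sum_(a : 'F_p) legendre a = 0.
Proof.
have [c lc] := legendre_nonresidue.
have c0 : c != 0 by apply: contra_eq_neq lc => ->; rewrite legendre0.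
have : \sum_(a : 'F_p) legendre a = - \sum_(a : 'F_p) legendre a.
  rewrite {1}(reindex_inj (mulfI c0)) /= -sumrN.
  by apply: eq_bigr => a _; rewrite legendreM lc mulN1r.
lia.
Qed.

End Legendre.

Section GaussSum.
Variables (p : nat) (pr : prime p) (p_odd : odd p) (L : fieldType) (z : L).
Hypotheses (zp : z ^+ p = 1) (z1 : z != 1).

Definition zeta_pow (a : 'F_p) : L := z ^+ a.

Lemma zeta_pow_nat n : zeta_pow n%:R = z ^+ n.
Proof. by rewrite /zeta_pow val_Fp_nat // (expr_mod _ zp). Qed.

Lemma zeta_powD a b : zeta_pow (a + b) = zeta_pow a * zeta_pow b.
Proof.
by rewrite -(natr_Zp a) -(natr_Zp b) -natrD !zeta_pow_nat exprD.
Qed.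

Lemma zeta_powX a n : zeta_pow a ^+ n = zeta_pow (a *+ n).
Proof.
elim: n => [|n IH]; first by rewrite mulr0n (zeta_pow_nat 0).
by rewrite exprS mulrS zeta_powD IH.
Qed.

Lemma sum_zeta_pow (d : 'F_p) :
  \sum_a zeta_pow (a * d) = if d == 0 then p%:R else 0.
Proof.
case: eqP => [->|/eqP d0].
  under eq_bigr do rewrite mulr0 (zeta_pow_nat 0) expr0.
  by rewrite sumr_const card_Fp.
have -> : \sum_a zeta_pow (a * d) = \sum_a zeta_pow a.
  by rewrite [RHS](reindex_inj (mulIf d0)).
have : z * \sum_a zeta_pow a = \sum_a zeta_pow a.
  rewrite [RHS](reindex_inj (addrI 1)) /= mulr_sumr; apply: eq_bigr => a _.
  by rewrite zeta_powD (zeta_pow_nat 1).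
move/eqP; rewrite -subr_eq0 -{2}[\sum_a _]mul1r -mulrBl mulf_eq0 subr_eq0.
by rewrite (negPf z1) => /eqP.
Qed.

Definition gauss_sum : L := \sum_a (legendre a)%:~R * zeta_pow a.

(** Put b = a c in the double sum over a, b: the sum over a nonzero is p - 1
    for c = -1 and -1 for the other c, where the symbols (c / p) add up to 0. *)
Lemma gauss_sum_sq : gauss_sum ^+ 2 = (legendre (-1 : 'F_p) * p%:Z)%:~R.
Proof.
have -> : gauss_sum ^+ 2 = \sum_(a : 'F_p | a != 0) \sum_(c : 'F_p)
    (legendre c)%:~R * zeta_pow (a * (1 + c)).
  rewrite expr2 big_distrlr /= (bigID (fun a : 'F_p => a == 0)) /=.
  rewrite big_pred1_eq big1 ?add0r => [|b _]; last by rewrite legendre0 !mul0r.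
  apply: eq_bigr => a a0; rewrite (reindex_inj (mulfI a0)) /=; apply: eq_bigr => c _.
  rewrite mulrACA -zeta_powD -rmorphM legendreM // mulrA legendre_sq // mul1r.
  by rewrite mulrDr mulr1.
rewrite exchange_big /=.
have inner (c : 'F_p) : \sum_(a : 'F_p | a != 0) zeta_pow (a * (1 + c))
    = (if c == -1 then p%:R else 0) - 1.
  have := sum_zeta_pow (1 + c); rewrite (bigD1 0) //= mul0r (zeta_pow_nat 0) expr0.
  by rewrite -[c == -1]addr_eq0 [c + 1]addrC => <-; rewrite [RHS]addrC addKr.
under eq_bigr do rewrite -mulr_sumr inner mulrBr mulr1.
rewrite sumrB -(rmorph_sum (intmul 1)) legendre_sum0 // subr0.
rewrite (bigD1 (-1)) //= eqxx big1 ?addr0 => [|c /negPf->]; last by rewrite mulr0.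
by rewrite rmorphM.
Qed.

(** In characteristic q, raising to the power q multiplies the exponents of
    the root of unity by q. *)
Lemma gauss_sum_frobenius q : q \in [pchar L] -> odd q -> ~~ (p %| q)%N ->
  gauss_sum ^+ q = (legendre (q%:R : 'F_p))%:~R * gauss_sum.
Proof.
move=> chq q_odd ndv.
have q0 : (q%:R : 'F_p) != 0 by rewrite -(dvdn_pcharf (pchar_Fp pr)).
rewrite -(pFrobenius_autE chq) /gauss_sum rmorph_sum /= mulr_sumr.
rewrite [RHS](reindex_inj (mulfI q0)) /=; apply: eq_bigr => a _.
rewrite pFrobenius_autE exprMn zeta_powX -(mulr_natl a q) legendreM // rmorphM /=.
have sq : (legendre (q%:R : 'F_p))%:~R * (legendre (q%:R : 'F_p))%:~R = 1 :> L.
  by rewrite -rmorphM /= legendre_sq.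
rewrite !mulrA sq mul1r; congr (_ * _); rewrite -rmorphXn /=.
have -> : legendre a ^+ q = legendre a; last by [].
have := legendre_mem a; rewrite !inE.
case/or3P=> /eqP->; rewrite ?expr1n //; first by rewrite expr0n; case: (q) q_odd.
by rewrite -signr_odd q_odd.
Qed.

End GaussSum.

(** A root of 1 + X + ... + X^(p-1) works: it is not 1, where this
    polynomial takes the nonzero value p. *)
Lemma root_of_unity_exists (L : closedFieldType) p :
  prime p -> p%:R != 0 :> L -> exists z : L, z ^+ p = 1 /\ z != 1.
Proof.
move=> pr p0; pose P : {poly L} := \sum_(i < p) 'X^i.
have P1 : P.[1] = p%:R.
  rewrite horner_sum; under eq_bigr do rewrite hornerXn expr1n.
  by rewrite sumr_const card_ord.
have /closed_rootP[z rz] : size P != 1%N.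
  apply/negP => /eqP sP; have : P`_1 = 0 by rewrite nth_default ?sP.
  have p1 := prime_gt1 pr.
  rewrite coef_sum (bigD1 (Ordinal p1)) //= coefXn eqxx big1 ?addr0 => [/eqP|i ne].
    by rewrite oner_eq0.
  by rewrite coefXn; case: eqP => // e; case/negP: ne; apply/eqP/val_inj; rewrite /= -e.
exists z; split; last first.
  by apply: contraNneq p0 => z1; rewrite -P1 -z1 -rootE.
apply/eqP; rewrite -subr_eq0 subrX1.
have -> : \sum_(i < p) z ^+ i = P.[z].
  by rewrite horner_sum; apply: eq_bigr => i _; rewrite hornerXn.
by rewrite (rootP rz) mulr0.
Qed.

Definition jacobi (s : seq nat) (n : nat) : int := \prod_(p <- s) legendre (n%:R : 'F_p).

(** The prime discriminant p* = (-1)^((p-1)/2) p of an odd prime p. *)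
Definition prime_disc (p : nat) : int := legendre (-1 : 'F_p) * p%:Z.

Lemma prime_discE p : prime p -> odd p -> exists m : int, prime_disc p = 4 * m + 1.
Proof.
move=> pr p_odd; rewrite /prime_disc legendreN1 // -signr_odd.
have pE : p%:Z = (p./2)%:Z * 2 + 1 by lia.
have hE : (p./2)%:Z = (p./2./2)%:Z * 2 + odd p./2 by lia.
rewrite pE hE; case: (odd _) => /=; first by exists (- (p./2./2)%:Z - 1); ring.
by exists (p./2./2)%:Z; ring.
Qed.

(** Quadratic reciprocity, in the form needed for a Jacobi symbol.  The product
    of the Gauss sums is a square root of the product of the p* in an algebraic
    closure of F_q, and Frobenius multiplies it by the Jacobi symbol; when this
    symbol is 1, the square root lies in F_q. *)
Lemma reciprocity_square (s : seq nat) (q : nat) :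
  prime q -> odd q -> all (fun p => [&& prime p, odd p & p != q]) s ->
  jacobi s q = 1 -> exists y : 'F_q, y ^+ 2 = (\prod_(p <- s) prime_disc p)%:~R.
Proof.
move=> prq q_odd s_ok jac1.
have [L [i _]] := countable_algebraic_closure 'F_q.
have chL : q \in [pchar L] by rewrite (fmorph_pchar i) pchar_Fp.
have [g gq g2] : exists2 g : L, g ^+ q = (jacobi s q)%:~R * g
    & g ^+ 2 = (\prod_(p <- s) prime_disc p)%:~R.
  elim: s s_ok {jac1} => [_|p s IH /= /andP[/and3P[pr p_odd pq] /IH[g gq g2]]].
    by exists 1; rewrite ?expr1n /jacobi !big_nil ?mulr1.
  have p0 : p%:R != 0 :> L by rewrite -(dvdn_pcharf chL) dvdn_prime2 // eq_sym.
  have [z [zp z1]] := root_of_unity_exists pr p0.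
  exists (gauss_sum p z * g); rewrite exprMn ?gauss_sum_sq //.
    rewrite (gauss_sum_frobenius pr p_odd zp chL) ?dvdn_prime2 // gq /jacobi big_cons.
    by rewrite rmorphM /= mulrACA.
  by rewrite g2 big_cons [RHS]rmorphM.
rewrite jac1 mul1r in gq.
have : (map_poly i ('X^#|'F_q| - 'X)).[g] = 0.
  by rewrite card_Fp // rmorphB /= map_polyXn map_polyX !hornerE gq subrr.
rewrite finField_genPoly rmorph_prod horner_prod => /eqP/prodf_eq0[y _].
rewrite rmorphB /= map_polyX map_polyC !hornerE subr_eq0 => /eqP gy.
by exists y; apply: (fmorph_inj i); rewrite rmorphXn /= -gy g2 rmorph_int.
Qed.

Lemma odd_prime_factors n : (0 < n)%N -> odd n ->
  exists2 s : seq nat, all (fun p => prime p && odd p) s & n = (\prod_(p <- s) p)%N.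
Proof.
have [m] := ubnP n; elim: m n => // m IH n lt_nm n0 n_odd.
have [n1|n1] := leqP n 1.
  by exists [::]; rewrite ?big_nil //; lia.
have /dvdnP[n' def_n] := pdiv_dvd n; have pr := pdiv_prime n1.
have := n_odd; rewrite {1}def_n oddM => /andP[odd' oddp].
have [|||s s_ok sE] := IH n'; rewrite //.
- have := prime_gt1 pr; move: (pdiv n) def_n => p def_n p1; nia.
- by case: (n') odd'.
exists (pdiv n :: s); first by rewrite /= pr oddp.
by rewrite big_cons -sE mulnC.
Qed.

Lemma prod_prime_disc s : all (fun p => prime p && odd p) s ->
  (exists m : int, \prod_(p <- s) prime_disc p = 4 * m + 1) /\
  (\prod_(p <- s) prime_disc p = (\prod_(p <- s) p)%N%:Z \/
   \prod_(p <- s) prime_disc p = - (\prod_(p <- s) p)%N%:Z).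
Proof.
elim: s => [_|p s IH /= /andP[/andP[pr p_odd] /IH[[m mE] sgn]]].
  by rewrite !big_nil; split; [exists 0 | left].
have [k kE] := prime_discE pr p_odd; rewrite !big_cons PoszM; split.
  by exists (4 * k * m + k + m); rewrite mE kE; ring.
rewrite {1 3}/prime_disc legendreN1 // -signr_odd.
by case: (odd _); case: sgn => ->; rewrite ?expr0 ?expr1; [right|left|left|right]; ring.
Qed.

Section Jacobi.
Variables (s : seq nat) (s_ok : all (fun p => prime p && odd p) s).

Lemma jacobiM m n : jacobi s (m * n) = jacobi s m * jacobi s n.
Proof.
rewrite /jacobi -big_split /= big_seq [RHS]big_seq; apply: eq_bigr => p ps.
by have /andP[pr p_odd] := allP s_ok p ps; rewrite natrM legendreM.
Qed.

Lemma jacobi_periodic M n : (\prod_(p <- s) p %| M)%N -> jacobi s (n + M) = jacobi s n.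
Proof.
move=> dv; rewrite /jacobi big_seq [RHS]big_seq; apply: eq_bigr => p ps.
have /andP[pr _] := allP s_ok p ps.
have /eqP M0 : M%:R == 0 :> 'F_p.
  rewrite -(dvdn_pcharf (pchar_Fp pr)); apply: dvdn_trans dv.
  by rewrite (big_rem p ps) dvdn_mulr.
by rewrite natrD M0 addr0.
Qed.

Lemma jacobi_coprime n : coprime n (\prod_(p <- s) p) -> jacobi s n = 1 \/ jacobi s n = -1.
Proof.
move: s_ok; rewrite /jacobi.
elim: s => [_ _|p t IH /= /andP[/andP[pr p_odd] t_ok]]; first by rewrite big_nil; left.
rewrite !big_cons coprimeMr => /andP[co /(IH t_ok)].
have : legendre (n%:R : 'F_p) = 1 \/ legendre (n%:R : 'F_p) = -1.
  rewrite /legendre -(dvdn_pcharf (pchar_Fp pr)).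
  by rewrite coprime_sym prime_coprime // in co; rewrite (negPf co); case: ifP; [left | right].
by case=> -> [] ->; [left|right|right|left].
Qed.

End Jacobi.

(** * The auxiliary number *)

(** A maximal multiplicatively closed set S that contains S0 and avoids -1 meets
    every pair u, -u of units: if u is not in S, then the union of S and u S is
    closed because u^2 is in S, so it contains -1 = u s, and
    -u = s u^2.  On units, S is the kernel of a character of order 2 that is
    -1 at -1. *)
Lemma half_unit_set (R : finComUnitRingType) (S0 : {set R}) :
  {in S0 &, forall x y, x * y \in S0} ->
  (forall x, x \is a GRing.unit -> x ^+ 2 \in S0) -> -1 \notin S0 ->
  exists S : {set R}, [/\ S0 \subset S, {in S &, forall x y, x * y \in S},
    -1 \notin S & forall u, u \is a GRing.unit -> u \notin S -> - u \in S].
Proof.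
move=> mulS0 sqS0 N1S0.
pose P (S : {set R}) := [&& S0 \subset S,
  [forall x in S, forall y in S, x * y \in S] & -1 \notin S].
have [|S /maxsetP[/and3P[subS mulS N1S] maxS] _] := @maxset_exists _ P S0.
  rewrite /P subxx N1S0 andbT /=; apply/forall_inP => x xS; apply/forall_inP => y yS.
  exact: mulS0.
have {}mulS : {in S &, forall x y, x * y \in S}.
  by move=> x y xS yS; move/forall_inP: mulS => /(_ x xS)/forall_inP/(_ y yS).
exists S; split=> // u uu uS.
have sqS x : x \is a GRing.unit -> x ^+ 2 \in S by move=> /sqS0; apply: (subsetP subS).
pose B := S :|: [set u * x | x in S].
have S1 : 1 \in S by rewrite -(expr1n _ 2) sqS ?unitr1.
have nPB : ~~ P B.
  apply/negP => /maxS BS; case/negP: uS; rewrite -BS ?subsetUl // inE.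
  by apply/orP; right; apply/imsetP; exists 1; rewrite ?mulr1.
have : -1 \in B.
  apply: contraR nPB => N1B; rewrite /P N1B andbT (subset_trans subS) ?subsetUl //=.
  apply/forall_inP => x xB; apply/forall_inP => y yB; move: xB yB; rewrite !inE.
  have usq : u * u \in S by rewrite -expr2 sqS.
  case/orP => [xS|/imsetP[x' x'S ->]]; case/orP => [yS|/imsetP[y' y'S ->]].
  - by rewrite mulS.
  - by rewrite mulrCA imset_f ?orbT // mulS.
  - by rewrite -mulrA imset_f ?orbT // mulS.
  - by rewrite mulrACA mulS // mulS.
rewrite inE (negPf N1S) => /imsetP[s sS e].
have -> : - u = s * u ^+ 2 by rewrite -mulN1r e; ring.
by rewrite mulS // sqS.
Qed.

Lemma legendre7_3 : legendre (3%:R : 'F_7) = -1.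
Proof. by rewrite /legendre; vm_compute. Qed.

Section AuxiliaryNumber.
Variable K : nat.
Hypotheses (K1 : (1 < K)%N) (K4 : (K %% 4 = 1)%N) (K7 : ~~ (7 %| K)%N).

(** The condition on A says that -7 is K times a square mod A. *)
Definition admissible (A : nat) : Prop := odd A /\ exists b, (A %| K * b ^ 2 + 7)%N.

Lemma admissible_coprime A : admissible A -> coprime A K.
Proof.
case=> _ [b Ab]; have : (gcdn A K %| 7)%N.
  rewrite -(dvdn_addr 7 (_ : (gcdn A K %| K * b ^ 2)%N)) ?dvdn_mulr ?dvdn_gcdr //.
  by apply: dvdn_trans Ab; apply: dvdn_gcdl.
have /primeP[_ pr7] : prime 7 by [].
move=> /pr7/orP[//|/eqP g7].
by case/negP: K7; rewrite -g7 dvdn_gcdr.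
Qed.

Lemma admissible_dvd A B : admissible A -> (B %| A)%N -> admissible B.
Proof.
case=> oA [b Ab] BA; split; last by exists b; apply: dvdn_trans Ab.
by case/dvdnP: BA oA => k ->; rewrite oddM => /andP[].
Qed.

Lemma dvdn_quadratic_mod m n A : m = n %[mod A] ->
  (A %| K * m ^ 2 + 7)%N = (A %| K * n ^ 2 + 7)%N.
Proof.
by move=> e; rewrite /dvdn -modnDml -modnMmr -modnXm e modnXm modnMmr modnDml.
Qed.

Lemma admissibleM A B : coprime A B -> admissible A -> admissible B -> admissible (A * B).
Proof.
move=> co [oA [a Aa]] [oB [b Bb]]; split; first by rewrite oddM oA.
exists (chinese A B a b); rewrite Gauss_dvd //; apply/andP; split.
  by rewrite (dvdn_quadratic_mod (chinese_modl co a b)).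
by rewrite (dvdn_quadratic_mod (chinese_modr co a b)).
Qed.

Let Zunit n : ((n%:R : 'Z_K) \is a GRing.unit) = coprime n K.
Proof. by rewrite unitZpE // coprime_sym. Qed.

(** Allowing a square factor makes this set a group, by
    [admissible_classesM]: a product of two admissible numbers need not be
    admissible, but it is after division by the square of their gcd. *)
Definition admissible_classes : {set 'Z_K} :=
  [set x | `[< exists A s, [/\ admissible A, s \is a GRing.unit & x = A%:R * s ^+ 2] >]].

Lemma admissible_classesM : {in admissible_classes &, forall x y, x * y \in admissible_classes}.
Proof.
move=> x y; rewrite !inE => /asboolP[A [s [gA us ->]]] /asboolP[B [t [gB ut ->]]].
apply/asboolP; have oA := gA.1; have A0 : (0 < A)%N by case: (A) oA.
pose d := gcdn A B; have d0 : (0 < d)%N by rewrite gcdn_gt0 A0.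
have [dA dB] := (dvdn_gcdl A B, dvdn_gcdr A B).
exists ((A %/ d) * (B %/ d))%N, (d%:R * s * t); split.
- apply: admissibleM; first by rewrite /coprime -(eqn_pmul2r d0) mul1n muln_gcdl !divnK.
    by apply: admissible_dvd gA _; apply: dvdn_div.
  by apply: admissible_dvd gB _; apply: dvdn_div.
- rewrite !unitrM us ut !andbT Zunit; exact: coprime_dvdl dA (admissible_coprime gA).
have [-> ->] : A%:R = (A %/ d)%:R * d%:R :> 'Z_K /\ B%:R = (B %/ d)%:R * d%:R :> 'Z_K.
  by rewrite -!natrM !divnK.
by rewrite natrM; ring.
Qed.

Lemma admissible_classes_sq x : x \is a GRing.unit -> x ^+ 2 \in admissible_classes.
Proof.
move=> ux; rewrite inE; apply/asboolP; exists 1%N, x; split; rewrite ?mul1r //.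
by split=> //; exists 0%N; rewrite dvd1n.
Qed.

(** As 7 K = 3 mod 4, the product of the p* over the primes p of 7 K is -7 K,
    and -7 K = y^2 mod q gives K (y / K)^2 = -7 mod q. *)
Lemma admissible_prime s q : all (fun p => prime p && odd p) s ->
  (\prod_(p <- s) p = 7 * K)%N ->
  prime q -> odd q -> coprime q (7 * K) -> jacobi s q = 1 -> admissible q.
Proof.
move=> s_ok sE pr q_odd co jac; split=> //.
have s_ok' : all (fun p => [&& prime p, odd p & p != q]) s.
  apply/allP => p ps; have /andP[-> ->] /= := allP s_ok p ps.
  apply: contraTneq co => pq; rewrite -sE -pq (big_rem p ps) /= coprimeMr.
  by rewrite /coprime gcdnn -[p == 1]/(p == 1)%N gtn_eqF // prime_gt1 // pq.
have [y yE] := reciprocity_square pr q_odd s_ok' jac.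
have [[m mE] sgn] := prod_prime_disc s_ok.
have prodE : \prod_(p <- s) prime_disc p = - (7 * K)%N%:Z.
  by case: sgn; rewrite sE // => e; exfalso; move: mE; rewrite e; lia.
have uK : (K%:R : 'F_q) != 0.
  rewrite -(dvdn_pcharf (pchar_Fp pr)) -prime_coprime //.
  by move: co; rewrite coprimeMr => /andP[].
exists (y / K%:R : 'F_q); rewrite (dvdn_pcharf (pchar_Fp pr)).
rewrite natrD natrM natrX natr_Zp expr_div_n yE prodE.
rewrite rmorphN /= -pmulrn natrM; apply/eqP; field.
exact: uK.
Qed.

(** The duality argument.  Working modulo 14 K makes the primes q found below
    odd and prime to 7 K. *)
Lemma neg1_admissible_class : -1 \in admissible_classes.
Proof.
apply: contraT => N1.
have [S [subS mulS N1S halfS]] := half_unit_set admissible_classesM admissible_classes_sq N1.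
have K_odd : odd K by move: (modn2 K); lia.
have K0 : (0 < K)%N by exact: ltnW.
have [s s_ok sE] := odd_prime_factors K0 K_odd.
have s7_ok : all (fun p => prime p && odd p) (7 :: s) by rewrite /= s_ok.
have s7E : (\prod_(p <- 7%N :: s) p = 7 * K)%N by rewrite big_cons -sE.
pose M := (14 * K)%N.
have M1 : (1 < M)%N by rewrite /M; lia.
have coM n : coprime n M = [&& odd n, coprime n 7 & coprime n K].
  by rewrite /M coprimeMr (coprimeMr _ 2 7) coprimen2 andbA.
pose c1 n : int := if (n%:R : 'Z_K) \in S then 1 else -1.
have c1M m n : coprime m M -> coprime n M -> c1 (m * n)%N = c1 m * c1 n.
  rewrite !coM => /and3P[_ _]; rewrite -Zunit => um /and3P[_ _]; rewrite -Zunit => un.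
  rewrite /c1 natrM; move: (m%:R) (n%:R) um un => {m n} x y ux uy.
  have sqS u : u \is a GRing.unit -> u ^+ 2 \in S.
    by move=> ?; apply: (subsetP subS); apply: admissible_classes_sq.
  have both u : u \is a GRing.unit -> u \in S -> - u \notin S.
    move=> uu uS; apply: contra N1S => NuS.
    have -> : -1 = u * - u * u^-1 ^+ 2 :> 'Z_K.
      by rewrite mulrN mulNr -expr2 -exprMn mulrV // expr1n.
    by apply: (mulS _ _ (mulS _ _ uS NuS)); apply: sqS; rewrite unitrV.
  have uxy : x * y \is a GRing.unit by rewrite unitrM ux.
  case: (boolP (x \in S)) => xS; case: (boolP (y \in S)) => yS.
  - by rewrite mulS.
  - suff /negPf-> : x * y \notin S by [].
    have := both (- (x * y)); rewrite opprK unitrN; apply=> //.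
    by rewrite -mulrN mulS // halfS.
  - suff /negPf-> : x * y \notin S by [].
    have := both (- (x * y)); rewrite opprK unitrN; apply=> //.
    by rewrite -mulNr mulS // halfS.
  - by rewrite -mulrNN mulS ?halfS.
have c1_per n : c1 (n + M)%N = c1 n.
  by rewrite /c1 /M natrD natrM pchar_Zp // mulr0 addr0.
have c1_val n : coprime n M -> c1 n = 1 \/ c1 n = -1.
  by rewrite /c1; case: ifP; [left | right].
have chi1P : real_character M (fun n => if coprime n M then c1 n else 0).
  apply: real_character_of_units => //.
  have co : coprime 14 K by move: K7; rewrite (coprimeMl K 2 7) coprime2n K_odd prime_coprime.
  (* A number in the class of -1 mod K. *)
  exists (chinese 14 K 1 K.-1).
    rewrite /M coprimeMr -coprime_modl chinese_modl //= -coprime_modl chinese_modr //.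
    by rewrite coprime_modl coprimePn.
  rewrite /c1 -Zp_nat_mod // chinese_modr // Zp_nat_mod // -subn1 natrB // pchar_Zp // sub0r.
  by rewrite (negPf N1S).
have jacM : (\prod_(p <- 7%N :: s) p %| M)%N by rewrite s7E /M -[14%N]/(2 * 7)%N -mulnA dvdn_mull.
have coM7 n : coprime n M -> coprime n (\prod_(p <- 7%N :: s) p).
  by rewrite s7E coM coprimeMr => /and3P[_ -> ->].
pose c2 n := c1 n * jacobi (7%N :: s) n.
have chi2P : real_character M (fun n => if coprime n M then c2 n else 0).
  apply: real_character_of_units => [m n com con|n|n co|].
  - by rewrite /c2 c1M // jacobiM // mulrACA.
  - by rewrite /c2 c1_per jacobi_periodic.
  - rewrite /c2; case: (c1_val n co) => ->; case: (jacobi_coprime s7_ok (coM7 _ co)) => ->.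
    + by left.
    + by right.
    + by right.
    + by left.
  have co : coprime (2 * K) 7 by rewrite coprimeMl /= coprime_sym prime_coprime.
  (* 3 is not a square mod 7, so the Jacobi symbol is -1 at this n = 1 mod K. *)
  pose n := chinese (2 * K) 7 1 3; exists n.
    rewrite /M (_ : 14 * K = 2 * K * 7)%N; last by lia.
    by rewrite coprimeMr -coprime_modl chinese_modl // coprime_modl coprime1n
       -coprime_modl chinese_modr.
  have n1 : (n = 1 %[mod 2 * K])%N by rewrite chinese_modl.
  have n1p p : (p %| K)%N -> prime p -> n%:R = 1 :> 'F_p.
    move=> pK pr; have p2K : (p %| 2 * K)%N by rewrite dvdn_mull.
    by rewrite -(Fp_nat_mod pr) -(modn_dvdm _ p2K) n1 (modn_dvdm _ p2K) Fp_nat_mod.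
  have n1K : n%:R = 1 :> 'Z_K.
    have KK : (K %| 2 * K)%N by rewrite dvdn_mull.
    by rewrite -(Zp_nat_mod K1) -(modn_dvdm _ KK) n1 (modn_dvdm _ KK) Zp_nat_mod.
  have S1 : 1 \in S by rewrite -(expr1n _ 2) (subsetP subS) ?admissible_classes_sq ?unitr1.
  rewrite /c2 /c1 n1K S1 mul1r /jacobi big_cons big_seq big1 ?mulr1.
    by rewrite -(@Fp_nat_mod 7) // chinese_modr // legendre7_3.
  move=> p ps; have /andP[pr p_odd] := allP s_ok p ps.
  by rewrite n1p ?legendre1 // sE (big_rem p ps) dvdn_mulr.
have [q [pr]] := common_inert_prime M1 chi1P chi2P.
case: ifP => // co cq1; rewrite /c2 cq1 mulN1r => /oppr_inj jac1.
have /and3P[q_odd _ _] : [&& odd q, coprime q 7 & coprime q K] by rewrite -coM.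
have gq : admissible q by apply: admissible_prime jac1 => //; rewrite -s7E coM7.
move: cq1; rewrite /c1 (subsetP subS) // inE; apply/asboolP.
by exists q, 1; rewrite expr1n mulr1 unitr1; split.
Qed.

End AuxiliaryNumber.

(** * The quaternary form *)

(** From an odd A with K a = A + beta^2 and K b^2 + 7 = 4 A c, the form
    K x^2 + a y^2 + c z^2 + b y z + 2 beta x y has half-discriminant
    4 c (K a - beta^2) - K b^2 = 7, and it takes the value K at (1, 0, 0). *)
Lemma ternary_disc7_represents (K : nat) : (K %% 4 = 1)%N -> ~~ (7 %| K)%N ->
  exists x y z : int, x ^+ 2 + (y ^+ 2 + y * z + 2 * z ^+ 2) = K%:Z.
Proof.
move=> K4 K7; have [K1|K1] := leqP K 1.
  by exists 1, 0, 0; have -> : K = 1%N by lia.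
have := neg1_admissible_class K1 K4 K7; rewrite inE => /asboolP[A [s [gA us e]]].
have [A_odd [b0 Ab0]] := gA.
(* An odd b makes K b^2 + 7 divisible by 4, because K = 1 mod 4. *)
have [b b_odd Ab] : exists2 b, odd b & (A %| K * b ^ 2 + 7)%N.
  have [o|e0] := boolP (odd b0); first by exists b0.
  exists (b0 + A)%N; first by rewrite oddD (negPf e0).
  by rewrite (@dvdn_quadratic_mod K (b0 + A) b0) // modnDr.
pose beta : nat := s^-1.
have Kb : (K %| A + beta ^ 2)%N.
  have : (A + beta ^ 2)%:R = 0 :> 'Z_K.
    rewrite natrD natrX /beta natr_Zp; apply: (mulIr us); apply: (mulIr us).
    by rewrite !mul0r -mulrA -expr2 mulrDl -exprMn mulVr // expr1n -e addNr.
  by move/(congr1 val); rewrite /= val_Zp_nat // => /eqP.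
have A4 : coprime A 4 by rewrite (coprimeMr A 2 2) coprimen2 A_odd.
have bc : (A * 4 %| K * b ^ 2 + 7)%N.
  rewrite Gauss_dvd // Ab /=.
  have [t ->] : exists t, b = (2 * t + 1)%N by exists b./2; clear -b_odd; lia.
  have [k ->] : exists k, K = (4 * k + 1)%N by exists (K %/ 4)%N; clear -K4; lia.
  apply/dvdnP; exists (4 * k * t * t + 4 * k * t + k + t * t + t + 2)%N.
  by rewrite -mulnn; ring.
have /dvdnP[a aE] := Kb; have /dvdnP[c cE] := bc.
clearbody beta; have aEz : a%:Z * K%:Z = A%:Z + beta%:Z ^+ 2 by clear -aE; lia.
have cEz : c%:Z * (A%:Z * 4) = K%:Z * b%:Z ^+ 2 + 7 by clear -cE; lia.
have A0 : 0 < A%:Z by case: (A) A_odd.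
have disc : 4 * K%:Z * a%:Z - (2 * beta%:Z) ^+ 2 = 4 * A%:Z.
  by rewrite -mulrA [K%:Z * _]mulrC aEz; ring.
have [|||x [y [z xyz]]] :=
  @ternary_disc7_class K a c b 0 (2 * beta%:Z) _ _ _ 1 0 0.
- by clear -K1; lia.
- by rewrite disc; clear -A0; lia.
- rewrite (_ : _ - _ = c%:Z * (4 * K%:Z * a%:Z - (2 * beta%:Z) ^+ 2) - K%:Z * b%:Z ^+ 2).
    by rewrite disc [4 * _]mulrC cEz; ring.
  by ring.
by exists x, y, z; rewrite -xyz; ring.
Qed.

(** If z is even, y^2 + y z + 2 z^2 = (y + z / 2)^2 + 7 (z / 2)^2.  If z is odd
    and the norm is divisible by 4, then y + z w is divisible by the square of
    one of the two primes above 2, and replacing this square by 2 = pi pi' does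
    not change the norm and leads to the order.  Conjugation, which sends y to
    -(y + z), reduces to the case y = 2 mod 4. *)
Lemma norm_in_order (y z : int) :
  ((y ^+ 2 + y * z + 2 * z ^+ 2) %% 4)%Z <> 2 ->
  exists r s : int, r ^+ 2 + 7 * s ^+ 2 = y ^+ 2 + y * z + 2 * z ^+ 2.
Proof.
have [k [d [zE d01]]] : exists k d : int, z = 2 * k + d /\ (d = 0 \/ d = 1).
  by exists (z %/ 2)%Z, (z %% 2)%Z; lia.
case: d01 zE => -> zE n2; first by exists (y + k), k; rewrite zE; ring.
have y2 w : (w %% 4)%Z = 2 -> 
  exists r s : int, r ^+ 2 + 7 * s ^+ 2 = w ^+ 2 + w * z + 2 * z ^+ 2.
  move=> w2; have [j wE] : exists j, w = 4 * j + 2 by exists (w %/ 4)%Z; lia.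
  by exists (w - (j + k + 1)), (- (j + k + 1)); rewrite wE zE; ring.
have [h [e [yE e03]]] : exists h e : int, y = 4 * h + e /\ 0 <= e < 4.
  by exists (y %/ 4)%Z, (y %% 4)%Z; lia.
have [g [f [kE f01]]] : exists g f : int, k = 2 * g + f /\ 0 <= f < 2.
  by exists (k %/ 2)%Z, (k %% 2)%Z; lia.
have [/y2//|[/y2[r [s rs]]|no]] : (y %% 4)%Z = 2 \/ ((- (y + z)) %% 4)%Z = 2
   \/ ((y %% 4)%Z <> 2 /\ ((- (y + z)) %% 4)%Z <> 2) by lia.
  by exists r, s; rewrite rs; ring.
exfalso; apply: n2; case: no => no1 no2.
have ef : (f = 0 /\ (e = 0 \/ e = 3)) \/ (f = 1 /\ (e = 0 \/ e = 1)) by lia.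
clear -zE yE kE ef; subst z y k.
by case: ef => -[f0 [] e0]; subst f e; lia.
Qed.

(** A square is 0 or 1 mod 4, so K - x^2 is 0 or 1 mod 4. *)
Lemma one_mod4_represented (K : nat) : (K %% 4 = 1)%N -> ~~ (7 %| K)%N ->
  exists x y z : int, x ^+ 2 + y ^+ 2 + 7 * z ^+ 2 = K%:Z.
Proof.
move=> K4 /(ternary_disc7_represents K4)[x [y [z e]]].
have [|r [s rs]] := @norm_in_order y z; last by exists x, r, s; rewrite -e -rs; ring.
have [k [d [xE d01]]] : exists k d : int, x = 2 * k + d /\ (d = 0 \/ d = 1).
  by exists (x %/ 2)%Z, (x %% 2)%Z; lia.
by move: e; case: d01 xE => -> ->; move: (_ + _ + _) => N; lia.
Qed.

Definition represented (n : nat) : Prop :=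
  exists t x y z : int, t ^+ 2 + x ^+ 2 + 7 * y ^+ 2 + 7 * z ^+ 2 = n%:Z.

Lemma represented_mul7 n : represented n -> represented (7 * n).
Proof.
by case=> t [x [y [z e]]]; exists (7 * y), (7 * z), t, x; rewrite PoszM -e; ring.
Qed.

Lemma represented_mul2 n : represented n -> represented (2 * n).
Proof.
case=> t [x [y [z e]]]; exists (t + x), (t - x), (y + z), (y - z).
by rewrite PoszM -e; ring.
Qed.

Lemma represented_div7 n : represented (7 * n) -> represented n.
Proof.
case=> t [x [y [z e]]].
have [t' [x' [tE xE]]] : exists t' x' : int, t = 7 * t' /\ x = 7 * x'.
  have [t' [a [tE a7]]] : exists t' a : int, t = 7 * t' + a /\ 0 <= a < 7.
    by exists (t %/ 7)%Z, (t %% 7)%Z; lia.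
  have [x' [b [xE b7]]] : exists x' b : int, x = 7 * x' + b /\ 0 <= b < 7.
    by exists (x %/ 7)%Z, (x %% 7)%Z; lia.
  have ab : ((a ^+ 2 + b ^+ 2) %% 7)%Z = 0.
    clear -e tE xE; subst t x; lia.
  suff [a0 b0] : a = 0 /\ b = 0 by exists t', x'; rewrite tE xE a0 b0 !addr0.
  (* The residues a, b mod 7 are checked one by one. *)
  clear -ab a7 b7; case: a a7 ab => // a; case: b b7 => // b b7 a7.
  by do 7 (case: a a7 => [|a] a7; first by do 7 (case: b b7 => [|b] b7; first by []); lia); lia.
exists y, z, t', x'; apply: (@mulfI _ 7) => //.
by move: e; rewrite PoszM tE xE => <-; ring.
Qed.

(** The conditional stops the enumeration at the first hit even when it is
    evaluated by value. *)
Fixpoint search (P : BinNat.N.t -> bool) (k : nat) (i : BinNat.N.t) : bool :=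
  if k is k'.+1 then if P i then true else search P k' (BinNat.N.succ i) else false.

Lemma searchP P k i : search P k i -> exists j, P j.
Proof. by elim: k i => //= k IH i; case: ifP => [|_ /IH //]; exists i. Qed.

Definition search_representation (n : BinNat.N.t) : bool :=
  let sq i := BinNat.N.mul i i in
  search (fun y => search (fun z =>
    let m := BinNat.N.mul (BinNat.N.of_nat 7) (BinNat.N.add (sq y) (sq z)) in
    search (fun t =>
      if BinNat.N.leb (BinNat.N.add m (sq t)) n then
        let x := BinNat.N.sqrt (BinNat.N.sub n (BinNat.N.add m (sq t))) in
        BinNat.N.eqb (BinNat.N.add (BinNat.N.add m (sq t)) (sq x)) n
      else false) 40 (BinNat.N.of_nat 0)) 15 (BinNat.N.of_nat 0)) 15 (BinNat.N.of_nat 0).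

Lemma search_representationP n : search_representation (BinNat.N.of_nat n) -> represented n.
Proof.
case/searchP=> y /searchP[z] /searchP[t]; case: ifP => // _.
move: (BinNat.N.sqrt _) => x /BinNat.N.eqb_eq /(congr1 BinNat.N.to_nat).
rewrite !(Nnat.N2Nat.inj_add, Nnat.N2Nat.inj_mul) !Nnat.Nat2N.id !plusE !multE => <-.
pose to_int i : int := (BinNat.N.to_nat i)%:Z.
exists (to_int t), (to_int x), (to_int y), (to_int z).
by rewrite !(PoszD, PoszM) /to_int; ring.
Qed.

(** 1575 = 7 * 15^2 is the largest number subtracted in [odd_represented]. *)
Lemma odd_represented_small n :
  (n < 1575)%N -> odd n -> n != 3%N -> ~~ (7 %| n)%N -> represented n.
Proof.
move=> lt_n n_odd n3 n7; apply: search_representationP.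
have : all (fun n => (odd n && (n != 3) && ~~ (7 %| n))%N ==> search_representation (BinNat.N.of_nat n))
  (iota 0 1575) by vm_compute.
by move/allP/(_ n); rewrite mem_iota add0n leq0n lt_n n_odd n3 n7 => /(_ isT).
Qed.

Lemma odd_represented n : odd n -> n != 3%N -> ~~ (7 %| n)%N -> represented n.
Proof.
move=> n_odd n3 n7; have [lt_n|ge_n] := ltnP n 1575; first exact: odd_represented_small.
have [n4|n4] : (n %% 4 = 1)%N \/ (n %% 4 = 3)%N by clear -n_odd; lia.
  by have [x [y [z e]]] := one_mod4_represented n4 n7; exists x, y, z, 0; rewrite -e; ring.
have step (w c K : nat) : n = (7 * w ^ 2 + c ^ 2 * K)%N -> (K %% 4 = 1)%N -> represented n.
  move=> nE K4; have K7 : ~~ (7 %| K)%N.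
    by apply: contra n7 => K7; rewrite nE dvdn_add //; [apply: dvdn_mulr | apply: dvdn_mull].
  have [x [y [z e]]] := one_mod4_represented K4 K7.
  exists (c%:Z * x), (c%:Z * y), (c%:Z * z), w%:Z.
  have sqz m : (m ^ 2)%N%:Z = m%:Z ^+ 2 by rewrite -mulnn PoszM.
  by rewrite nE PoszD (PoszM 7) (PoszM (c ^ 2)%N) -e !sqz; ring.
(* Subtracting 7 w^2 leaves c^2 K with K = 1 mod 4. *)
have pick (w c : nat) : (7 * w ^ 2 <= n)%N -> ((n - 7 * w ^ 2) %% (4 * c ^ 2) = c ^ 2)%N ->
    (0 < c)%N -> represented n.
  move=> le_w mod_c c0; set d := (n - 7 * w ^ 2)%N in mod_c *.
  have dE := divn_eq d (4 * c ^ 2); rewrite mod_c in dE.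
  apply: (step w c (4 * (d %/ (4 * c ^ 2)) + 1)%N); last by rewrite mulnC modnMDl.
  rewrite mulnDr muln1 mulnA [(c ^ 2 * 4)%N]mulnC [(_ * (_ %/ _))%N]mulnC -dE /d.
  by rewrite subnKC.
have small_w w : (w <= 15)%N -> (7 * w ^ 2 <= n)%N.
  by move=> le_w; apply: leq_trans ge_n; rewrite -mulnn; clear -le_w; nia.
(* If n = 3 mod 8, some w in {1, 3} gives n - 7 w^2 = 4 mod 16.  If n = 7 mod 8,
   some odd w <= 15 gives n - 7 w^2 = 16 mod 64. *)
have [n8|n8] : (n %% 8 = 3)%N \/ (n %% 8 = 7)%N by clear -n4; lia.
  have [n16|n16] : (n %% 16 = 3)%N \/ (n %% 16 = 11)%N by clear -n8; lia.
    by apply: (pick 3%N 2%N); rewrite ?small_w //; clear -n16 ge_n; lia.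
  by apply: (pick 1%N 2%N); rewrite ?small_w //; clear -n16 ge_n; lia.
have : (n %% 64 \in [:: 7; 15; 23; 31; 39; 47; 55; 63])%N by rewrite !inE; clear -n8; lia.
rewrite !inE => /or4P[/eqP r|/eqP r|/eqP r|/or4P[/eqP r|/eqP r|/eqP r|/orP[/eqP r|/eqP r]]].
- by apply: (pick 9%N 4%N); rewrite ?small_w //; clear -r ge_n; lia.
- by apply: (pick 3%N 4%N); rewrite ?small_w //; clear -r ge_n; lia.
- by apply: (pick 1%N 4%N); rewrite ?small_w //; clear -r ge_n; lia.
- by apply: (pick 11%N 4%N); rewrite ?small_w //; clear -r ge_n; lia.
- by apply: (pick 7%N 4%N); rewrite ?small_w //; clear -r ge_n; lia.
- by apply: (pick 13%N 4%N); rewrite ?small_w //; clear -r ge_n; lia.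
- by apply: (pick 15%N 4%N); rewrite ?small_w //; clear -r ge_n; lia.
- by apply: (pick 5%N 4%N); rewrite ?small_w //; clear -r ge_n; lia.
Qed.

Definition exceptional (n : nat) : Prop :=
  exists e l : nat, (e = 0%N \/ e = 1%N) /\ n = (2 ^ e * 3 * 7 ^ l)%N.

Lemma exceptional_mul7 n : exceptional n -> exceptional (7 * n).
Proof.
by case=> e [l [e01 ->]]; exists e, l.+1; split; rewrite // [in RHS]expnS mulnCA.
Qed.

Lemma exceptional_not_represented n : exceptional n -> ~ represented n.
Proof.
case=> e [l [e01 ->]]; elim: l => [|l IH]; last by rewrite expnS mulnCA => /represented_div7.
case=> t [x [y [z E]]].
have nE : (2 ^ e * 3 * 7 ^ 0 = 3)%N \/ (2 ^ e * 3 * 7 ^ 0 = 6)%N by case: e01 => ->; [left | right].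
have small (w : int) : 0 <= w ^+ 2 by apply: sqr_ge0.
have sq (w : int) : w ^+ 2 < 7 -> w ^+ 2 \in [:: 0; 1; 4 : int].
  move=> w7; have wb : - 2 <= w <= 2.
    apply/andP; split; rewrite leNgt; apply/negP => w3.
      have : 0 <= (3 - w) * (- 3 - w) by apply: mulr_ge0; clear -w3; lia.
      by clear -w7; lia.
    have : 0 <= (w - 3) * (w + 3) by apply: mulr_ge0; clear -w3; lia.
    by clear -w7; lia.
  by have [|[|[|[|]]]] : w = 0 \/ w = 1 \/ w = -1 \/ w = 2 \/ w = -2 by [clear -wb; lia]; move=> ->.
have [[[t0 x0] y0] z0] := (small t, small x, small y, small z).
have {nE}E : t ^+ 2 + x ^+ 2 + 7 * y ^+ 2 + 7 * z ^+ 2 = 3 \/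
    t ^+ 2 + x ^+ 2 + 7 * y ^+ 2 + 7 * z ^+ 2 = 6 by rewrite E; case: nE => ->; [left | right].
have := sq t; have := sq x; rewrite !inE.
clear -E t0 x0 y0 z0; lia.
Qed.

Lemma represented_of_not_exceptional n : (0 < n)%N -> ~ exceptional n -> represented n.
Proof.
have [m] := ubnP n; elim: m n => // m IH n lt_n n0 nexc.
have [/dvdnP[k nE]|n7] := boolP (7 %| n)%N.
  rewrite {}nE mulnC in lt_n n0 nexc *; apply/represented_mul7/IH; try by clear -lt_n n0; lia.
  by move=> /exceptional_mul7.
have [n_odd|n_even] := boolP (odd n).
  apply: odd_represented => //; apply/eqP => n3; apply: nexc.
  by exists 0%N, 0%N; split; [left | rewrite n3].
have n6 : n != 6%N by apply/eqP => n6; apply: nexc; exists 1%N, 0%N; split; [right | rewrite n6].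
have [k nE] : exists k, n = (2 * k)%N by exists n./2; clear -n_even; lia.
subst n; have [k_odd|k_even] := boolP (odd k).
  apply/represented_mul2/odd_represented => //; first by clear -n6; lia.
  by apply: contra n7; apply: dvdn_mull.
have [j kE] : exists j, k = (2 * j)%N by exists k./2; clear -k_even; lia.
subst k; have [j3|j3] := eqVneq j 3%N; first by exists 2, 1, 1, 0; rewrite j3.
have [j6|j6] := eqVneq j 6%N; first by exists 3, 1, 1, 1; rewrite j6.
do 2 apply: represented_mul2.
apply: IH; try by clear -lt_n n0; lia.
case=> e [[|l] [e01 jE]].
  by move: jE j3 j6; case: e01 => -> ->.
by case/negP: n7; rewrite jE expnS !mulnA dvdn_mulr // dvdn_mull.
Qed.

Theorem theorem2 (n : nat) (hn : (0 < n)%N) :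
  (exists t x y z : int, (t ^+ 2 + x ^+ 2 + 7 * y ^+ 2 + 7 * z ^+ 2 = n%:Z)%R)
  <->
  ~ (exists e l : nat, (e = 0%N \/ e = 1%N) /\ n = (2 ^ e * 3 * 7 ^ l)%N).
Proof.
split=> [rep exc|]; first exact: exceptional_not_represented exc rep.
exact: represented_of_not_exceptional.
Qed.
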